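(* Let $3\le s\le k\le5$ be integers and let $u$ be a totally real algebraic integer with $2<u<14$ such that the matrix $$A=\begin{pmatrix}-2&u&2\cos\frac{\pi}{s}\\ u&-2&2\cos\frac{\pi}{k}\\ 2\cos\frac{\pi}{s}&2\cos\frac{\pi}{k}&-2\end{pmatrix}$$ is V-arithmetic, with ground field $\mathbb K=\mathbb Q\big(u^2,\cos^2\frac{\pi}{s},\cos^2\frac{\pi}{k},u\cos\frac{\pi}{s}\cos\frac{\pi}{k}\big)$. Then: $[\mathbb K:\mathbb Q]\le23$ for $s=k=3$; $[\mathbb K:\mathbb Q]\le12$ for $s=3,k=4$; $[\mathbb K:\mathbb Q]\le8$ for $s=k=4$; $\mathbb Q(\sqrt5)\subset\mathbb K$ and $[\mathbb K:\mathbb Q(\sqrt5)]\le7$ for $s=3,k=5$; for $s=4,k=5$: if $\sqrt2\in\mathbb K$ then $\mathbb Q(\sqrt2,\sqrt5)\subset\mathbb K$ and $[\mathbb K:\mathbb Q(\sqrt2,\sqrt5)]\le5$, and if $\sqrt2\notin\mathbb K$ then $\mathbb Q(\sqrt5)\subset\mathbb K$ and $[\mathbb K:\mathbb Q(\sqrt5)]\le11$; $\mathbb Q(\sqrt5)\subset\mathbb K$ and $[\mathbb K:\mathbb Q(\sqrt5)]\le6$ for $s=k=5$. In particular $[\mathbb K:\mathbb Q]\le23$ in all these cases.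
   Context: A fundamental matrix is a real symmetric matrix $A=(a_{ij})$ with $a_{ii}=-2$, $a_{ij}\ge0$ for $i\ne j$, and $a_{ij}=2\cos(\pi/m_{ij})$ for an integer $m_{ij}\ge2$ whenever $a_{ij}<2$. It is hyperbolic if it has exactly one positive eigenvalue. Its cyclic products are $a_{i_1i_2}a_{i_2i_3}\cdots a_{i_ki_1}$; its ground field $\mathbb K$ is the field generated over $\mathbb Q$ by all cyclic products. A hyperbolic fundamental matrix is V-arithmetic if all cyclic products are algebraic integers, the field $\mathbb Q(\{a_{ij}\})$ is totally real, and for every embedding $\varphi:\mathbb Q(\{a_{ij}\})\to\mathbb R$ whose restriction to $\mathbb K$ is not the identity inclusion, the matrix $(\varphi(a_{ij}))$ is negative definite. All fields are regarded as subfields of $\mathbb R$. *)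

(* Defs.v *)
From HB Require Import structures.
From mathcomp Require Import all_boot all_order all_algebra all_field.
Set Implicit Arguments. Unset Strict Implicit. Unset Printing Implicit Defensive.
Import Order.TTheory GRing.Theory Num.Theory.
Local Open Scope ring_scope.

(* 2 cos(pi/m) as an element of algC: m.-root (-1) = exp(i pi / m). *)
Definition twocos (m : nat) : algC := m.-root (-1) + (m.-root (-1))^*.

(* A subfield of algC (every such subfield contains Q). *)
Definition is_subfield (F : algC -> Prop) : Prop :=
  [/\ F 1,
      forall x y, F x -> F y -> F (x - y),
      forall x y, F x -> F y -> F (x * y) &
      forall x, F x -> x != 0 -> F x^-1].

Definition gen_field (S : algC -> Prop) : algC -> Prop :=
  fun x => forall F, is_subfield F -> (forall y, S y -> F y) -> F x.

Definition Qfield : algC -> Prop := gen_field (fun _ => False).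

Definition field_degree (F L : algC -> Prop) (n : nat) : Prop :=
  exists b : 'I_n -> algC,
    [/\ forall i, L (b i),
        (forall c : 'I_n -> algC, (forall i, F (c i)) ->
            \sum_i c i * b i = 0 -> forall i, c i = 0) &
        (forall x, L x -> exists2 c : 'I_n -> algC,
            (forall i, F (c i)) & x = \sum_i c i * b i)].

Definition degree_le (F L : algC -> Prop) (d : nat) : Prop :=
  exists2 n, field_degree F L n & (n <= d)%N.

Definition subset_field (F L : algC -> Prop) : Prop := forall x, F x -> L x.

Definition cyc_prod n (A : 'M[algC]_n) (i : 'I_n) (s : seq 'I_n) : algC :=
  let t := i :: s in
  \prod_(j < size t) A (nth i t j) (nth i t (j.+1 %% size t)).

Definition is_cyc_prod n (A : 'M[algC]_n) (x : algC) : Prop :=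
  exists i s, x = cyc_prod A i s.

Definition ground_field n (A : 'M[algC]_n) : algC -> Prop :=
  gen_field (is_cyc_prod A).

Definition entry_field n (A : 'M[algC]_n) : algC -> Prop :=
  gen_field (fun x => exists i j, x = A i j).

Definition fundamental n (A : 'M[algC]_n) : Prop :=
  [/\ A^T = A,
      forall i, A i i = -2,
      forall i j, i != j -> 0 <= A i j &
      forall i j, i != j -> A i j < 2 -> exists2 m, (2 <= m)%N & A i j = twocos m].

Definition hyperbolic n (A : 'M[algC]_n) : Prop :=
  exists l : algC, [/\ 0 < l, mup l (char_poly A) = 1%N &
     forall l', 0 < l' -> root (char_poly A) l' -> l' = l].

Definition neg_definite n (A : 'M[algC]_n) : Prop :=
  forall v : 'rV[algC]_n, (forall i, v 0 i \is Num.real) -> v != 0 ->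
    (v *m A *m v^T) 0 0 < 0.

(* Field embeddings into R (resp. C) of number fields in algC are the
   restrictions of automorphisms of algC. *)
Definition totally_real_field (F : algC -> Prop) : Prop :=
  forall nu : {rmorphism algC -> algC}, forall x, F x -> nu x \is Num.real.

Definition V_arithmetic n (A : 'M[algC]_n) : Prop :=
  [/\ fundamental A, hyperbolic A,
      (forall x, is_cyc_prod A x -> x \in Aint),
      totally_real_field (entry_field A) &
      forall nu : {rmorphism algC -> algC},
        (exists2 x, ground_field A x & nu x != x) ->
        neg_definite (map_mx nu A)].

Definition totally_real (x : algC) : Prop :=
  forall nu : {rmorphism algC -> algC}, nu x \is Num.real.

Definition Amat (u cs ck : algC) : 'M[algC]_3 :=
  \matrix_(i < 3, j < 3)
    nth 0 (nth [::] [:: [:: -2; u; cs]; [:: u; -2; ck]; [:: cs; ck; -2]] i) j.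

Definition sqrt5 : algC := sqrtC 5%:R.
Definition sqrt2 : algC := sqrtC 2%:R.
Definition Qsqrt5 : algC -> Prop := gen_field (fun x => x = sqrt5).
Definition Qsqrt2sqrt5 : algC -> Prop := gen_field (fun x => x = sqrt2 \/ x = sqrt5).

(* Main.v *)
Require Import Defs.
From HB Require Import structures.
From mathcomp Require Import all_boot all_order all_algebra all_field.
From mathcomp Require Import ring lra.
Set Implicit Arguments. Unset Strict Implicit. Unset Printing Implicit Defensive.
Import Order.TTheory GRing.Theory Num.Theory.
Local Open Scope ring_scope.

(** Write c = 2cos(pi/s), d = 2cos(pi/k) and y = u^2 + ucd, an algebraic integer
    of K. If an automorphism nu of the algebraic numbers moves some element of K,
    negative definiteness of the conjugate matrix confines nu(y) to the interval
    [- nu(cd)^2 / 4, 4 - nu(c)^2 - nu(d)^2[, whereas y > 4; hence nu fixes y only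
    if it fixes K, so that K = Q(y). In each case an integer polynomial w in y
    (and in the golden ratio when k = 5) is uniformly small on these intervals,
    and its value at y itself is bounded because u < 14. Its norm is a nonzero
    integer, which bounds the number of conjugates of y. *)

(** * Conjugates in the algebraic numbers *)

(** Why [y] rather than u^2: the conjugates of u^2 are only confined to [0, 4[, and on an interval
    of length 4 a nonconstant integer polynomial has supremum at least 2 (Chebyshev). The interval
    for nu(y) has length (4 - nu(c)^2)(4 - nu(d)^2) / 4 < 4, which leaves room for small integer
    polynomials. Its right end comes from the determinant of the conjugate matrix, 2 (nu(y) +
    nu(c)^2 + nu(d)^2 - 4), which must be negative; its left end from the fact that nu(y) + nu(cd)^2
    / 4 is the square of nu(u) + nu(cd) / 2. For k = 5 the interval is long when nu(sqrt5) = -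
    sqrt5, and the bound there may exceed 1. Since sqrt5 changes sign on exactly half of the
    conjugates, it suffices that the product of the two bounds is small. Fields are compared through
    automorphisms of [algC]: x lies in Q(t) when every automorphism fixing t fixes x. *)

Notation autC := {rmorphism algC -> algC}.

(** The splitting field of [minCpoly y] is realized as a number field inside [algC]. The map sending
    y to r extends from Q(y) to this normal extension, and from there to an automorphism of
    [algC]. *)
Lemma aut_root_minCpoly (y r : algC) :
  root (minCpoly y) r -> {nu : autC | nu y = r}.
Proof.
move=> yr.
have [q [Dq mon_q] dv_q] := minCpolyP y.
have [rs Drs] := closed_field_poly_normal (minCpoly y).
rewrite (monicP (minCpoly_monic y)) scale1r in Drs.
have [Qs [QsC [s1 Ds1 gens1]]] := num_field_exists rs.
have QsCE (p : {poly rat}) : map_poly QsC (map_poly (in_alg Qs) p) = map_poly ratr p.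
  rewrite -map_poly_comp; apply: eq_map_poly => a /=.
  by rewrite alg_num_field fmorph_rat.
have Dp : map_poly (in_alg Qs) q = \prod_(z <- s1) ('X - z%:P).
  apply: (map_poly_inj QsC); rewrite QsCE -Dq Drs -Ds1 rmorph_prod big_map.
  by apply: eq_bigr => z _; rewrite rmorphB /= map_polyX map_polyC.
have inv_root z : root (minCpoly y) z -> {z1 | z1 \in s1 & QsC z1 = z}.
  by rewrite Drs root_prod_XsubC -Ds1 => /mapP/sig2_eqW[z1 ? ->]; exists z1.
have [zy zy_in Dzy] := inv_root _ (root_minCpoly y).
have [zr zr_in Dzr] := inv_root _ yr.
have hom1 : kHom 1 1 (\1%VF : 'End(Qs)) by rewrite kHom1.
have rt : root (map_poly \1%VF (minPoly 1 zy)) zr.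
  rewrite (_ : map_poly _ _ = minPoly 1 zy); last first.
    by rewrite map_poly_id // => a _; rewrite id_lfunE.
  have [q1 Dq1] : exists q1, minPoly 1 zy = map_poly (in_alg Qs) q1.
    have aP i : (minPoly 1 zy)`_i \in 1%VS.
      by apply/polyOverP; apply: minPolyOver.
    have a_ i := sig_eqW (vlineP _ _ (aP i)).
    exists (\poly_(i < size (minPoly 1 zy)) sval (a_ i)).
    apply/polyP=> i; rewrite coef_map coef_poly /=.
    case: (ltnP i (size (minPoly 1 zy))) => [_|le_i]; first by case: (a_ i).
    by rewrite nth_default // scale0r.
  have: root (minPoly 1 zy) zy by apply: root_minPoly.
  rewrite Dq1 -(fmorph_root QsC) QsCE Dzy dv_q => /dvdpP[q2 ->].
  by rewrite -(fmorph_root QsC) QsCE Dzr rmorphM rootM /= -Dq yr orbT.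
pose E := <<1; zy>>%AS.
have homE : kHom 1 E (kHomExtend 1 \1 zy zr) by apply: kHomExtendP.
have split1 : splittingFieldFor 1 (map_poly (in_alg Qs) q) {:Qs}.
  by exists s1 => //; rewrite Dp eqpxx.
have q_over : map_poly (in_alg Qs) q \is a polyOver 1%VS.
  by apply/polyOverP => i; rewrite coef_map /= memvZ ?mem1v.
have splitE := splittingFieldForS (sub1v E) (subvf E) split1.
have [g homg Dg] := kHom_extends (sub1v E) homE q_over splitE.
have gm : monoid_morphism g by apply/kHom_monoid_morphism.
pose gM := GRing.isMonoidMorphism.Build _ _ g gm.
pose gRM : {rmorphism _ -> _} := HB.pack (fun_of_lfun g) gM.
have [nu Dnu] := extend_algC_subfield_aut QsC gRM.
exists nu; rewrite -Dzy -Dnu /= -Dg ?memv_adjoin // -Dzr; congr (QsC _).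
have := kHomExtend_poly hom1 rt (polyOverX _).
by rewrite hornerX map_polyX hornerX.
Qed.

Lemma root_minCpoly_aut (nu : autC) (y : algC) : root (minCpoly y) (nu y).
Proof. by rewrite -(minCpoly_aut nu) root_minCpoly. Qed.

(** By transitivity on conjugates, x is the only root of its minimal polynomial, which is therefore
    a power of X - x. Its subleading coefficient is rational and a nonzero integer multiple of x. *)
Lemma fixed_Crat (x : algC) : (forall nu : autC, nu x = x) -> x \in Crat.
Proof.
move=> fix_x; have [q [Dq _] _] := minCpolyP x.
have [rs Drs] := closed_field_poly_normal (minCpoly x).
rewrite (monicP (minCpoly_monic x)) scale1r in Drs.
have rs_x r : r \in rs -> r = x.
  by rewrite -root_prod_XsubC -Drs => /aut_root_minCpoly[nu <-].
have rs_gt0 : (0 < size rs)%N.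
  have := size_minCpoly x; rewrite Drs size_prod_XsubC; by case: (size rs).
have trace : (minCpoly x)`_(size rs).-1 = - (x *+ size rs).
  rewrite Drs coefPn_prod_XsubC -?lt0n // (eq_big_seq (fun=> x)) //.
  by rewrite big_const_seq count_predT iter_addr_0.
rewrite -(mulfK (_ : (size rs)%:R != 0) x) ?pnatr_eq0 -?lt0n //.
rewrite mulr_natr -[x *+ _]opprK -trace Dq coef_map.
by rewrite rpred_div ?rpredN ?Crat_rat ?rpred_nat.
Qed.

(** Membership of x in Q(t), in Galois form. Every automorphism fixes 0, so [in_Qof 0] stands for
    Q. *)
Definition in_Qof (t x : algC) : Prop := forall nu : autC, nu t = t -> nu x = x.

Lemma in_Qof_trans y x z : in_Qof x y -> in_Qof y z -> in_Qof x z.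
Proof. by move=> xy yz nu /xy/yz. Qed.

Lemma in_Qof_subfield t : is_subfield (in_Qof t).
Proof.
split=> [nu _|x y xt yt nu nut|x y xt yt nu nut|x xt _ nu nut].
- by rewrite rmorph1.
- by rewrite rmorphB xt ?yt.
- by rewrite rmorphM xt ?yt.
- by rewrite fmorphV xt.
Qed.

Lemma in_QofD t x y : in_Qof t x -> in_Qof t y -> in_Qof t (x + y).
Proof. by move=> xt yt nu nut; rewrite rmorphD xt ?yt. Qed.

Lemma in_Qof_aut_eq y x (nu mu : autC) : in_Qof y x -> nu y = mu y -> nu x = mu x.
Proof.
move=> yx nu_mu; apply: (can_inj (algC_invautK mu)).
rewrite algC_autK; apply: (yx (algC_invaut mu \o nu)).
by rewrite /= nu_mu algC_autK.
Qed.

(** A chosen automorphism taking y to r, with the identity as default when r is not a conjugate of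
    y. On elements of Q(y) the choice is immaterial, by [in_Qof_aut_eq]. *)
Definition conj_aut (y r : algC) : autC :=
  match @idP (root (minCpoly y) r) with
  | ReflectT yr => sval (aut_root_minCpoly yr)
  | ReflectF _ => idfun
  end.

Lemma conj_autE y r : root (minCpoly y) r -> conj_aut y r y = r.
Proof.
by rewrite /conj_aut; case: {-}_ / idP => // yr _; case: aut_root_minCpoly.
Qed.

Lemma conj_aut_in_Qof y x (nu : autC) : in_Qof y x -> conj_aut y (nu y) x = nu x.
Proof.
by move=> yx; apply: in_Qof_aut_eq yx _; rewrite conj_autE ?root_minCpoly_aut.
Qed.

(** For t in Q(y), the conjugates of y over Q(t); their number is the degree of Q(y) over Q(t). *)
Definition conj_over (t y : algC) : seq algC :=
  [seq r <- undup (sval (closed_field_poly_normal (minCpoly y))) |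
     conj_aut y r t == t].

Lemma conj_over_uniq t y : uniq (conj_over t y).
Proof. by rewrite filter_uniq ?undup_uniq. Qed.

Lemma mem_conj_over t y r : in_Qof y t ->
  reflect (exists2 nu : autC, nu t = t & nu y = r) (r \in conj_over t y).
Proof.
move=> yt; rewrite mem_filter mem_undup.
case: closed_field_poly_normal => rs /= Drs.
rewrite (monicP (minCpoly_monic y)) scale1r in Drs.
rewrite -root_prod_XsubC -Drs.
apply: (iffP andP) => [[/eqP rt yr]|[nu nut <-]].
  by exists (conj_aut y r); rewrite ?conj_autE.
by rewrite root_minCpoly_aut (conj_aut_in_Qof nu yt) nut.
Qed.

Lemma conj_over_aut t y r (nu : autC) : in_Qof y t -> nu t = t ->
  r \in conj_over t y -> nu r \in conj_over t y.
Proof.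
move=> yt nut /(mem_conj_over _ yt)[mu mut <-]; apply/mem_conj_over => //.
by exists (nu \o mu); rewrite //= mut.
Qed.

Lemma conj_over_perm t y (nu : autC) : in_Qof y t -> nu t = t ->
  perm_eq (map nu (conj_over t y)) (conj_over t y).
Proof.
move=> yt nut; have inj_nu := fmorph_inj nu.
have sub : {subset map nu (conj_over t y) <= conj_over t y}.
  by move=> _ /mapP[r r_in ->]; apply: conj_over_aut.
apply: uniq_perm; rewrite ?conj_over_uniq ?map_inj_uniq ?conj_over_uniq //.
by apply: (uniq_min_size _ sub _).2; rewrite ?map_inj_uniq ?conj_over_uniq ?size_map.
Qed.

Lemma interpolation (R : fieldType) (s : seq R) (g : R -> R) : uniq s ->
  exists2 h : {poly R}, (size h <= size s)%N & {in s, forall r, h.[r] = g r}.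
Proof.
elim: s => [|a s IHs] /=; first by exists 0; rewrite ?size_poly0.
case/andP=> as_ /IHs[h szh hg]; pose q := \prod_(r <- s) ('X - r%:P).
have qa : q.[a] != 0 by rewrite -rootE root_prod_XsubC.
exists (h + ((g a - h.[a]) / q.[a]) *: q) => [|r].
  rewrite (leq_trans (size_polyD _ _)) // geq_max (leq_trans szh) //=.
  by rewrite (leq_trans (size_scale_leq _ _)) // size_prod_XsubC.
rewrite inE hornerD hornerZ => /predU1P[->|rs]; first by rewrite divfK // addrC subrK.
by rewrite (rootP (_ : root q r)) ?root_prod_XsubC // mulr0 addr0 hg.
Qed.

Lemma poly_agree (R : fieldType) (s : seq R) (p q : {poly R}) :
  uniq s -> (size p <= size s)%N -> (size q <= size s)%N ->
  {in s, forall r, p.[r] = q.[r]} -> p = q.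
Proof.
move=> us sp sq pq; apply/eqP; rewrite -subr_eq0; apply/negPn/negP => nz.
have roots_s : all (root (p - q)) s.
  by apply/allP => r rs; rewrite rootE hornerD hornerN pq ?subrr.
have := max_poly_roots nz roots_s us; rewrite ltnNge (leq_trans (size_polyD _ _)) //.
by rewrite geq_max sp size_polyN.
Qed.

(** Interpolate the map from each conjugate of y to the corresponding conjugate of x. An
    automorphism fixing t permutes the nodes compatibly with the values, so uniqueness of the
    interpolant forces it to fix the coefficients. *)
Lemma in_Qof_poly t y x : in_Qof y t -> in_Qof y x ->
  exists2 h : {poly algC}, (size h <= size (conj_over t y))%N &
    (forall i, in_Qof t h`_i) /\ x = h.[y].
Proof.
move=> yt yx; pose s := conj_over t y.
have [h szh hE] := interpolation (fun r => conj_aut y r x) (conj_over_uniq t y).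
exists h => //; split=> [i nu nut|]; last first.
  rewrite hE; last by apply/mem_conj_over => //; exists idfun.
  exact/esym/(conj_aut_in_Qof idfun).
suff {2}<- : map_poly nu h = h by rewrite coef_map.
apply: (poly_agree (conj_over_uniq t y)); rewrite ?size_map_poly // => r.
rewrite -(perm_mem (conj_over_perm yt nut)) => /mapP[r1 r1s ->].
have -> : h.[nu r1] = conj_aut y (nu r1) x by apply: hE; apply: conj_over_aut.
have -> : (map_poly nu h).[nu r1] = nu (conj_aut y r1 x).
  by rewrite horner_map; congr (nu _); apply: hE.
have [nu1 _ <-] := mem_conj_over _ yt r1s.
by rewrite (conj_aut_in_Qof nu1 yx) (conj_aut_in_Qof (nu \o nu1) yx).
Qed.

(** The powers of y form the basis. They span by interpolation; they are independent because a
    relation is a polynomial vanishing at every conjugate, hence with more roots than its degree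
    allows. *)
Lemma field_degree_conj (F K : algC -> Prop) t y :
  (forall x, F x <-> in_Qof t x) -> (forall x, K x <-> in_Qof y x) ->
  in_Qof y t -> field_degree F K (size (conj_over t y)).
Proof.
move=> FE KE yt; exists (fun i => y ^+ i); split=> [i|c Fc c0 i|x /KE yx].
- by apply/KE => nu nuy; rewrite rmorphXn nuy.
- pose h := \poly_(i < size (conj_over t y)) nth 0 [seq c i | i <- enum 'I_(size (conj_over t y))] i.
  have hE (j : 'I_(size (conj_over t y))) : h`_j = c j.
    by rewrite coef_poly ltn_ord (nth_map j) ?size_enum_ord // nth_ord_enum.
  suff h0 : h = 0 by rewrite -hE h0 coef0.
  apply: (poly_agree (conj_over_uniq t y)); rewrite ?size_poly ?size_poly0 //.
  move=> _ /(mem_conj_over _ yt)[nu nut <-]; rewrite horner0.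
  rewrite (horner_coef_wide _ (size_poly _ _)).
  transitivity (nu (\sum_i c i * y ^+ i)); last by rewrite c0 rmorph0.
  rewrite rmorph_sum.
  apply: eq_bigr => j _; rewrite hE rmorphM rmorphXn.
  by rewrite ((FE (c j)).1 (Fc j) nu nut).
- have [h szh [hF ->]] := in_Qof_poly yt yx.
  exists (fun i => h`_i); last exact: horner_coef_wide.
  by move=> i; apply/FE.
Qed.

(** * Generated subfields and their description by automorphisms *)

Section SubfieldTheory.
Variables (F : algC -> Prop) (subF : is_subfield F).

Lemma subfield0 : F 0.
Proof. by have [F1 FB _ _] := subF; rewrite -(subrr 1); apply: FB. Qed.

Lemma subfieldD x y : F x -> F y -> F (x + y).
Proof.
move=> Fx Fy; have [_ FB _ _] := subF; rewrite -[y]opprK -[- y]sub0r.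
exact: (FB _ _ Fx (FB _ _ subfield0 Fy)).
Qed.

Lemma subfield_sum n (c : 'I_n -> algC) : (forall i, F (c i)) -> F (\sum_i c i).
Proof. by move=> Fc; apply: big_ind => //; [apply: subfield0 | apply: subfieldD]. Qed.

Lemma subfieldX x n : F x -> F (x ^+ n).
Proof.
move=> Fx; have [F1 _ FM _] := subF; elim: n => // n IHn.
by rewrite exprS; apply: FM.
Qed.

Lemma subfield_Crat x : x \in Crat -> F x.
Proof.
have [F1 FB FM FV] := subF.
have Fnat n : F n%:R.
  by elim: n => [|n IHn]; [apply: subfield0 | rewrite -addn1 natrD; apply: subfieldD].
have Fint z : z \is a Num.int -> F z.
  case/intrP=> -[n ->|n ->]; first exact: Fnat.
  by rewrite NegzE rmorphN -sub0r; apply: FB; [apply: subfield0 | apply: Fnat].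
case/CratP=> a ->; rewrite -[a]divq_num_den fmorph_div !rmorph_int.
apply: FM; first exact/Fint/intr_int.
by apply: FV; [apply/Fint/intr_int | rewrite intr_eq0 denq_eq0].
Qed.

(** Interpolation with base point 0: the coefficients are fixed by all automorphisms, hence
    rational, so x is a rational polynomial in y. *)
Lemma subfield_Qof y x : F y -> in_Qof y x -> F x.
Proof.
move=> Fy yx; have [F1 FB FM FV] := subF.
have y0 : in_Qof y 0 by move=> nu _; rewrite rmorph0.
have [h szh [hF ->]] := in_Qof_poly y0 yx.
rewrite horner_coef; apply: subfield_sum => i; apply: FM; last exact: subfieldX.
by apply/subfield_Crat/fixed_Crat => nu; apply: hF; rewrite rmorph0.
Qed.

End SubfieldTheory.

Lemma gen_field_subfield S : is_subfield (gen_field S).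
Proof.
split=> [F [] //|x y Kx Ky F subF FS|x y Kx Ky F subF FS|x Kx x0 F subF FS];
  have [F1 FB FM FV] := subF.
- by apply: FB; [apply: Kx | apply: Ky].
- by apply: FM; [apply: Kx | apply: Ky].
- by apply: FV => //; apply: Kx.
Qed.

Lemma gen_field_gen (S : algC -> Prop) x : S x -> gen_field S x.
Proof. by move=> Sx F _; apply. Qed.

Lemma gen_field_Qof (S : algC -> Prop) y :
  (forall x, S x -> in_Qof y x) -> gen_field S y ->
  forall x, gen_field S x <-> in_Qof y x.
Proof.
move=> Sy Ky x; split=> [Kx|]; first by apply: Kx Sy; apply: in_Qof_subfield.
by move=> yx; exact: (subfield_Qof (@gen_field_subfield S) Ky yx).
Qed.

(** The product inside the absolute value is the norm from Q(y) to Q. Automorphisms permute its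
    factors, so it is rational; being an algebraic integer too, it is an integer. *)
Lemma norm_conj_ge1 y w : in_Qof y w -> w \in Aint -> w != 0 ->
  1 <= \prod_(r <- conj_over 0 y) `|conj_aut y r w|.
Proof.
move=> yw wA w0; have y0 : in_Qof y 0 by move=> nu _; rewrite rmorph0.
rewrite -normr_prod; set N := \prod_(r <- _) _.
have NA : N \in Aint.
  rewrite /N; elim/big_ind: _ => [||r _]; rewrite ?rpred1 ?Aint_aut //.
  exact: rpredM.
have NQ : N \in Crat.
  apply: fixed_Crat => nu; have nu0 : nu 0 = 0 by rewrite rmorph0.
  rewrite /N rmorph_prod -[RHS](perm_big _ (conj_over_perm y0 nu0)) big_map.
  apply: eq_big_seq => r /(mem_conj_over _ y0)[mu _ <-].
  by rewrite (conj_aut_in_Qof mu yw) (conj_aut_in_Qof (nu \o mu) yw).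
apply: norm_intr_ge1; first exact: Cint_rat_Aint.
by rewrite /N prodf_seq_neq0; apply/allP => r _; rewrite fmorph_eq0.
Qed.

(** A quadratic step Q(t0) < Q(t1) in a tower: the conjugates of y over Q(t0) split according to the
    image of t1, and [tau] exchanges the two halves. *)
Lemma conj_over_double t0 t1 y (tau : autC) :
  in_Qof y t1 -> in_Qof t1 t0 -> tau t0 = t0 -> tau t1 != t1 ->
  tau (tau t1) = t1 ->
  (forall nu : autC, nu t0 = t0 -> nu t1 = t1 \/ nu t1 = tau t1) ->
  size (conj_over t0 y) = (size (conj_over t1 y)).*2.
Proof.
move=> y1 t10 tau0 tau1 tau2 two; have y0 := in_Qof_trans y1 t10.
pose P r := conj_aut y r t1 == t1.
have -> : size (conj_over t0 y) = (count P (conj_over t0 y) + count (predC P) (conj_over t0 y))%N.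
  by rewrite count_predC.
have -> : count P (conj_over t0 y) = size (conj_over t1 y).
  rewrite -size_filter; apply: perm_size; apply: uniq_perm.
  - by rewrite filter_uniq ?conj_over_uniq.
  - exact: conj_over_uniq.
  move=> r; rewrite mem_filter; apply/andP/idP.
    case=> /eqP Pr /(mem_conj_over _ y0)[nu _ nur]; apply/mem_conj_over => //.
    by exists nu => //; rewrite -(conj_aut_in_Qof nu y1) nur.
  case/(mem_conj_over _ y1)=> nu nut <-; rewrite /P (conj_aut_in_Qof nu y1) nut.
  by split=> //; apply/mem_conj_over => //; exists nu => //; apply: t10.
rewrite -addnn; congr (_ + _)%N; rewrite -size_filter.
set A := filter _ _; set B := conj_over t1 y.
have inj_tau := fmorph_inj tau.
have [uA uB] : uniq A /\ uniq B by rewrite filter_uniq conj_over_uniq.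
apply/eqP; rewrite eqn_leq; apply/andP; split.
  rewrite -(size_map tau A) uniq_leq_size ?map_inj_uniq // => _ /mapP[r rin ->].
  move: rin; rewrite mem_filter => /andP[+ /(mem_conj_over _ y0)[nu nut Dr]].
  rewrite -Dr /= /P (conj_aut_in_Qof nu y1).
  case: (two nu nut) => nu1; rewrite nu1 ?eqxx // => _.
  by apply/mem_conj_over => //; exists (tau \o nu); rewrite //= nu1.
rewrite -(size_map tau B) uniq_leq_size ?map_inj_uniq // => _ /mapP[r rin ->].
case/(mem_conj_over _ y1): rin => nu nut <-.
rewrite mem_filter /= /P (conj_aut_in_Qof (tau \o nu) y1) /= nut tau1.
by apply/mem_conj_over => //; exists (tau \o nu); rewrite //= (t10 nu nut).
Qed.

(** * Polynomial estimates on real intervals *)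

Section RealBounds.
Variable R : realFieldType.
Implicit Types x y z phi : R.

Lemma ler_normM (x y a b : R) : `|x| <= a -> `|y| <= b -> `|x * y| <= a * b.
Proof. by move=> xa yb; rewrite normrM ler_pM. Qed.

(** The maximum is 27/256, at z = 3/4; the product in the proof equals 27/256 minus the left
    side. *)
Lemma cube_mul_compl_le z : 0 <= z -> z <= 1 -> z ^+ 3 * (1 - z) <= 12 / 100.
Proof.
move=> z0 z1; have h : 0 <= (z - 3 / 4) ^+ 2 * (z ^+ 2 + z / 2 + 3 / 16).
  by rewrite mulr_ge0 ?sqr_ge0 // !addr_ge0 ?sqr_ge0 //; lra.
lra.
Qed.

Lemma bound33 y : - (1 * 1) / 4 <= y -> y <= 4 - 1 - 1 ->
  `|y ^+ 3 * (y - 1) ^+ 2 * (y - 2) ^+ 2 * (y ^+ 2 - y - 1)| <= 12 / 100.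
Proof.
move=> ly hy.
have [y0|y0] := lerP y 0.
  have -> : y ^+ 3 * (y - 1) ^+ 2 * (y - 2) ^+ 2 * (y ^+ 2 - y - 1) =
    y * y * ((y - 1) * (y - 1)) * ((y - 2) * (y - 2)) * (y * (y ^+ 2 - y - 1)) by ring.
  (* On [-1/4, 0] the factors are bounded separately; y (y^2 - y - 1) is at most 11/64 there, whence
     1/5. *)
  apply: (le_trans (y := (1/4) * (1/4) * ((5/4) * (5/4)) * ((9/4) * (9/4)) * 5^-1)); last by lra.
  have h1 : 0 <= (y + 1 / 4) * (- y) by rewrite mulr_ge0; lra.
  have h2 : 0 <= (y ^+ 2) * (- y) by rewrite mulr_ge0 ?sqr_ge0; lra.
  have h3 : 0 <= (y ^+ 2) * (y + 1 / 4) by rewrite mulr_ge0 ?sqr_ge0; lra.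
  have h4 : 0 <= y ^+ 2 by rewrite sqr_ge0.
  have h5 : 0 <= (y + 1 / 4) ^+ 2 by rewrite sqr_ge0.
  by rewrite !ler_normM // ler_norml; apply/andP; split; lra.
have h4 : 0 <= y ^+ 2 by rewrite sqr_ge0.
have [y1|y1] := lerP y 1.
  (* The square factors become z^2 (1 - z), since (1 - y)^2 = 1 - z. The remaining factor is at most
     z, the difference being y (1 - y)^2. *)
  pose z := y * (2 - y).
  have z0 : 0 <= z by rewrite mulr_ge0; lra.
  have z1 : 0 <= 1 - z by rewrite (_ : 1 - z = (1 - y) ^+ 2) ?sqr_ge0 // /z; ring.
  have -> : y ^+ 3 * (y - 1) ^+ 2 * (y - 2) ^+ 2 * (y ^+ 2 - y - 1) =
    - ((z ^+ 2 * (1 - z)) * (y * (1 + y - y ^+ 2))) by rewrite /z; ring.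
  have g0 : 0 <= 1 + y - y ^+ 2.
    have : 0 <= y * (1 - y) by rewrite mulr_ge0; lra.
    by move=> ?; lra.
  have q0 : 0 <= z ^+ 2 * (1 - z) by rewrite mulr_ge0 ?sqr_ge0.
  rewrite normrN (ger0_norm (mulr_ge0 q0 (mulr_ge0 (ltW y0) g0))).
  apply: le_trans (cube_mul_compl_le z0 _); last by rewrite -subr_ge0.
  rewrite (_ : z ^+ 3 * (1 - z) = z ^+ 2 * (1 - z) * z); last by ring.
  apply: ler_wpM2l => //.
  have : 0 <= y * (1 - y) ^+ 2 by rewrite mulr_ge0 ?sqr_ge0 ?(ltW y0).
  by rewrite /z => ?; lra.
(* Centering at 1 turns y (y - 2) into v - 1 with v = w^2, so that only the last factor is not a
   polynomial in v. *)
have [w Dy] : exists w, y = w + 1 by exists (y - 1); ring.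
have [v Dv] : exists v, v = w ^+ 2 by eexists.
have v0 : 0 <= v by rewrite Dv sqr_ge0.
have w0 : 0 <= w by lra.
have w1 : 0 <= 1 - w by lra.
have v1 : 0 <= 1 - v.
  have : 0 <= (1 - w) * (1 + w) by rewrite mulr_ge0 // addr_ge0.
  by rewrite Dv => ?; lra.
have -> : y ^+ 3 * (y - 1) ^+ 2 * (y - 2) ^+ 2 * (y ^+ 2 - y - 1) =
  (1 - v) ^+ 2 * v * (w ^+ 3 + 2 * w ^+ 2 - 1) by rewrite Dv Dy; ring.
have q0 : 0 <= (1 - v) ^+ 2 * v by rewrite mulr_ge0 ?sqr_ge0.
have h3 : 0 <= w * w ^+ 2 by rewrite mulr_ge0 ?sqr_ge0.
have v_le1 : 1 - v <= 1 by lra.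
rewrite ler_norml; apply/andP; split.
  have : (1 - v) ^+ 2 * v * - (w ^+ 3 + 2 * w ^+ 2 - 1) <= (1 - v) ^+ 2 * v * (1 - v).
    by apply: ler_wpM2l => //; lra.
  have := cube_mul_compl_le v1 v_le1.
  by clear => ? ?; lra.
have : (1 - v) ^+ 2 * v * (w ^+ 3 + 2 * w ^+ 2 - 1) <= (1 - v) ^+ 2 * v * (3 * v - 1).
  apply: ler_wpM2l => //; have : 0 <= (1 - w) * w ^+ 2 by rewrite mulr_ge0 ?sqr_ge0.
  by move=> ?; lra.
have : 0 <= (v - 2 / 3) ^+ 2 * (1 - v) * v by apply: mulr_ge0 (mulr_ge0 (sqr_ge0 _) v1) v0.
have : 0 <= (v - 1 / 2) ^+ 2 by apply: sqr_ge0.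
by clear => ? ? ?; lra.
Qed.

(** The extreme value is 3/32 at the left end -1/2, just below 47/500. The interior maximum of y^4
    (1 - y) is 256/3125 at y = 4/5, which explains the double root of the last witness. *)
Lemma bound34 y : - (1 * 2) / 4 <= y -> y <= 4 - 1 - 2 -> `|y ^+ 4 * (y - 1)| <= 47 / 500.
Proof.
move=> ly; rewrite (_ : 4 - 1 - 2 = 1); last by ring.
move=> hy; have y4 : 0 <= y ^+ 4 by rewrite (exprM y 2 2) sqr_ge0.
have : 0 <= y ^+ 4 * (1 - y) by rewrite mulr_ge0 ?subr_ge0.
move=> ?; rewrite ler_norml; apply/andP; split; last by lra.
have [y0|y0] := lerP y 0.
  have q : 0 <= y ^+ 2 <= 1 / 4.
    rewrite sqr_ge0; have : 0 <= (y + 1 / 2) * (1 / 2 - y) by rewrite mulr_ge0; lra.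
    by move=> ?; lra.
  have [q0 q1] := andP q.
  have : 0 <= (1 / 4 - y ^+ 2) * (1 / 4 + y ^+ 2) * (1 - y).
    by rewrite !mulr_ge0; lra.
  by move=> ?; lra.
have : 0 <= (y - 4 / 5) ^+ 2 * (y ^+ 3 + 3 / 5 * y ^+ 2 + 8 / 25 * y + 16 / 125).
  rewrite mulr_ge0 ?sqr_ge0 // !addr_ge0 ?mulr_ge0 ?exprn_ge0 ?(ltW y0) //; lra.
by move=> ?; lra.
Qed.

Lemma bound44 y : - (2 * 2) / 4 <= y -> y <= 4 - 2 - 2 -> `|y * (y + 1)| <= 1 / 4.
Proof.
move=> ly hy; have h1 : 0 <= (y + 1) * (- y) by rewrite mulr_ge0; lra.
have h2 : 0 <= (y + 1 / 2) ^+ 2 by apply: sqr_ge0.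
by rewrite ler_norml; apply/andP; split; lra.
Qed.

(* The rational bounds are quotients of consecutive Fibonacci numbers. *)
Lemma golden_pos phi : phi ^+ 2 = phi + 1 -> 0 < phi -> 144 / 89 <= phi <= 89 / 55.
Proof.
move=> e p; apply/andP; split; rewrite leNgt; apply/negP => h.
  have : 0 < phi * (144 / 89 - phi) by rewrite mulr_gt0 // subr_gt0.
  by rewrite mulrBr -expr2 e => ?; lra.
have : 0 < phi * (phi - 89 / 55) by rewrite mulr_gt0 // subr_gt0.
by rewrite mulrBr -expr2 e => ?; lra.
Qed.

Lemma golden_neg phi : phi ^+ 2 = phi + 1 -> phi < 0 -> - (34 / 55) <= phi <= - (55 / 89).
Proof.
move=> e p; have : 144 / 89 <= 1 - phi <= 89 / 55.
  by apply: golden_pos; [rewrite sqrrB e expr1n; ring | lra].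
by move=> ?; lra.
Qed.

(* The witnesses below multiply the square at an approximate critical point by
   a linear factor that is nonnegative on the interval. *)
Lemma bound35_pos y phi : phi ^+ 2 = phi + 1 -> 0 < phi ->
  - (1 * phi ^+ 2) / 4 <= y -> y <= 4 - 1 - phi ^+ 2 ->
  `|y * (y - 2 + phi) * (y - 1 + phi)| <= 3 / 40.
Proof.
move=> e p; have /andP[l h] := golden_pos e p; rewrite e => ly hy.
have -> : y * (y - 2 + phi) * (y - 1 + phi) =
  y ^+ 3 + (2 * phi - 3) * (y ^+ 2 - y) + y * (phi ^+ 2 - (phi + 1)) by ring.
rewrite e subrr mulr0 addr0.
have h1 : 0 <= (y + 37 / 100) ^+ 2 * (1 / 2 - y) by rewrite mulr_ge0 ?sqr_ge0; lra.
have h2 : 0 <= (y - 21 / 100) ^+ 2 * (y + 66 / 100) by rewrite mulr_ge0 ?sqr_ge0; lra.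
have h3 : 0 <= (phi - 144 / 89) * y ^+ 2 by rewrite mulr_ge0 ?sqr_ge0; lra.
have h4 : 0 <= (89 / 55 - phi) * y ^+ 2 by rewrite mulr_ge0 ?sqr_ge0; lra.
have h5 : 0 <= (phi - 144 / 89) * (y + 1) by rewrite mulr_ge0; lra.
have h6 : 0 <= (89 / 55 - phi) * (y + 1) by rewrite mulr_ge0; lra.
have h7 : 0 <= y ^+ 2 by apply: sqr_ge0.
have h8 : 0 <= (y + 66 / 100) * (1 / 2 - y) by rewrite mulr_ge0; lra.
by rewrite ler_norml; apply/andP; split; lra.
Qed.

Lemma bound35_neg y phi : phi ^+ 2 = phi + 1 -> phi < 0 ->
  - (1 * phi ^+ 2) / 4 <= y -> y <= 4 - 1 - phi ^+ 2 ->
  `|y * (y - 2 + phi) * (y - 1 + phi)| <= 5 / 4.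
Proof.
move=> e p; have /andP[l h] := golden_neg e p; rewrite e => ly hy.
have -> : y * (y - 2 + phi) * (y - 1 + phi) =
  y ^+ 3 + (2 * phi - 3) * (y ^+ 2 - y) + y * (phi ^+ 2 - (phi + 1)) by ring.
rewrite e subrr mulr0 addr0.
have h1 : 0 <= (y - 65 / 100) ^+ 2 * (294 / 100 - y) by rewrite mulr_ge0 ?sqr_ge0; lra.
have h2 : 0 <= (y - 217 / 100) ^+ 2 * (y + 1 / 10) by rewrite mulr_ge0 ?sqr_ge0; lra.
have h3 : 0 <= (phi + 34 / 55) * y ^+ 2 by rewrite mulr_ge0 ?sqr_ge0; lra.
have h4 : 0 <= (- (55 / 89) - phi) * y ^+ 2 by rewrite mulr_ge0 ?sqr_ge0; lra.
have h5 : 0 <= (phi + 34 / 55) * (y + 1) by rewrite mulr_ge0; lra.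
have h6 : 0 <= (- (55 / 89) - phi) * (y + 1) by rewrite mulr_ge0; lra.
have h7 : 0 <= y ^+ 2 by apply: sqr_ge0.
have h8 : 0 <= (y + 1 / 10) * (27 / 10 - y) by rewrite mulr_ge0; lra.
by rewrite ler_norml; apply/andP; split; lra.
Qed.

Lemma bound45_pos y phi : phi ^+ 2 = phi + 1 -> 0 < phi ->
  - (2 * phi ^+ 2) / 4 <= y -> y <= 4 - 2 - phi ^+ 2 ->
  `|y * (y - 1 + phi) * (y + phi)| <= 45 / 100.
Proof.
move=> e p; have /andP[l h] := golden_pos e p; rewrite e => ly hy.
have -> : y * (y - 1 + phi) * (y + phi) =
  y ^+ 3 + (2 * phi - 1) * y ^+ 2 + y + y * (phi ^+ 2 - (phi + 1)) by ring.
rewrite e subrr mulr0 addr0.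
have h1 : 0 <= (y + 12 / 10) ^+ 2 * (16 / 100 - y) by rewrite mulr_ge0 ?sqr_ge0; lra.
have h2 : 0 <= (y + 42 / 100) ^+ 2 * (y + 14 / 10) by rewrite mulr_ge0 ?sqr_ge0; lra.
have h3 : 0 <= (phi - 144 / 89) * y ^+ 2 by rewrite mulr_ge0 ?sqr_ge0; lra.
have h4 : 0 <= (89 / 55 - phi) * y ^+ 2 by rewrite mulr_ge0 ?sqr_ge0; lra.
have h7 : 0 <= y ^+ 2 by apply: sqr_ge0.
have h8 : 0 <= (y + 14 / 10) * (- y) by rewrite mulr_ge0; lra.
by rewrite ler_norml; apply/andP; split; lra.
Qed.

Lemma bound45_neg y phi : phi ^+ 2 = phi + 1 -> phi < 0 ->
  - (2 * phi ^+ 2) / 4 <= y -> y <= 4 - 2 - phi ^+ 2 ->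
  `|y * (y - 1 + phi) * (y + phi)| <= 45 / 100.
Proof.
move=> e p; have /andP[l h] := golden_neg e p; rewrite e => ly hy.
have -> : y * (y - 1 + phi) * (y + phi) =
  y ^+ 3 + (2 * phi - 1) * y ^+ 2 + y + y * (phi ^+ 2 - (phi + 1)) by ring.
rewrite e subrr mulr0 addr0.
have h1 : 0 <= (y - 28 / 100) ^+ 2 * (168 / 100 - y) by rewrite mulr_ge0 ?sqr_ge0; lra.
have h2 : 0 <= (y - 122 / 100) ^+ 2 * (y + 2 / 10) by rewrite mulr_ge0 ?sqr_ge0; lra.
have h3 : 0 <= (phi + 34 / 55) * y ^+ 2 by rewrite mulr_ge0 ?sqr_ge0; lra.
have h4 : 0 <= (- (55 / 89) - phi) * y ^+ 2 by rewrite mulr_ge0 ?sqr_ge0; lra.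
have h7 : 0 <= y ^+ 2 by apply: sqr_ge0.
have h8 : 0 <= (y + 2 / 10) * (168 / 100 - y) by rewrite mulr_ge0; lra.
by rewrite ler_norml; apply/andP; split; lra.
Qed.

Section Bound55.
Variables y phi : R.
Hypotheses (e : phi ^+ 2 = phi + 1).
Hypotheses (ly : - (phi ^+ 2 * phi ^+ 2) / 4 <= y) (hy : y <= 4 - phi ^+ 2 - phi ^+ 2).

(** Reduction modulo phi^2 = phi + 1 makes the endpoints linear in phi, as linear arithmetic
    requires. *)
Lemma bound55_interval : [/\ - (3 * phi + 2) / 4 <= y, y <= 2 - 2 * phi &
  (y - 2 + 2 * phi) * (y + phi) = y ^+ 2 + (3 * phi - 2) * y + 2].
Proof.
have e4 : phi ^+ 2 * phi ^+ 2 = 3 * phi + 2.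
  have -> : phi ^+ 2 * phi ^+ 2 = (phi ^+ 2 - (phi + 1)) * (phi ^+ 2 + phi + 2) + (3 * phi + 2).
    by ring.
  by rewrite e subrr mul0r add0r.
move: ly hy; rewrite e4 e => ? ?; split; [lra | lra |].
have -> : (y - 2 + 2 * phi) * (y + phi) =
  y ^+ 2 + (3 * phi - 2) * y + 2 + 2 * (phi ^+ 2 - (phi + 1)) by ring.
by rewrite e; ring.
Qed.

Lemma bound55_pos : 0 < phi -> `|(y - 2 + 2 * phi) * (y + phi)| <= 5 / 100.
Proof.
move=> p; have /andP[l h] := golden_pos e p; have [l1 l2 ->] := bound55_interval.
have h1 : 0 <= (y + (3 * phi + 2) / 4) * (2 - 2 * phi - y) by rewrite mulr_ge0; lra.
have h2 : 0 <= (y + (3 * phi + 2) / 4) * (2 - phi) by rewrite mulr_ge0; lra.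
(* The square centered at the vertex of the parabola in y, for the lower estimate. *)
have h3 : 0 <= (y + (3 * phi - 2) / 2) ^+ 2 by apply: sqr_ge0.
by move: e => e'; rewrite ler_norml; apply/andP; split; lra.
Qed.

Lemma bound55_neg : phi < 0 -> `|(y - 2 + 2 * phi) * (y + phi)| <= 215 / 100.
Proof.
move=> p; have /andP[l h] := golden_neg e p; have [l1 l2 ->] := bound55_interval.
have h1 : 0 <= (y + (3 * phi + 2) / 4) * (2 - 2 * phi - y) by rewrite mulr_ge0; lra.
have h2 : 0 <= (y + (3 * phi + 2) / 4) * (2 - phi) by rewrite mulr_ge0; lra.
have h3 : 0 <= (y + (3 * phi - 2) / 2) ^+ 2 by apply: sqr_ge0.
by move: e => e'; rewrite ler_norml; apply/andP; split; lra.
Qed.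

End Bound55.

Lemma sqrt2_le (x : R) : x ^+ 2 = 2 -> 0 < x -> x <= 10 / 7.
Proof.
move=> x2 x0; rewrite leNgt; apply/negP => h.
have : 0 < (x - 10 / 7) * (x + 10 / 7) by rewrite mulr_gt0; lra.
by move=> ?; lra.
Qed.

Lemma golden_mul_sqrt2_le x phi : x ^+ 2 = 2 -> 0 < x -> phi ^+ 2 = phi + 1 -> 0 < phi ->
  x * phi <= 10 / 7 * (89 / 55).
Proof.
move=> x2 x0 e p; have /andP[_ h] := golden_pos e p.
exact: ler_pM (ltW x0) (ltW p) (sqrt2_le x2 x0) h.
Qed.

End RealBounds.

(** * The values 2cos(pi/m) for m = 3, 4, 5 *)

Lemma twocos_root m : (0 < m)%N ->
  exists z w : algC, [/\ twocos m = z + w, z * w = 1, z ^+ m = -1 & w ^+ m = -1].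
Proof.
move=> m0; set z := m.-root (-1) : algC; exists z, z^*; have zm : z ^+ m = -1 by apply: rootCK.
split=> //; last by rewrite -rmorphXn /= zm rmorphN1.
by rewrite -normCK norm_rootC normrN1 rootC1 ?expr1n.
Qed.

(** [rootC_Re_max] treats roots with nonnegative imaginary part, and conjugation covers the others.
    This selects the right root of the polynomial equation satisfied by [twocos m]. *)
Lemma twocos_ge m (y : algC) : (0 < m)%N -> y ^+ m = -1 -> y + y^* <= twocos m.
Proof.
move=> m0 ym; rewrite /twocos; set z := m.-root (-1).
suff : 'Re y <= 'Re z by rewrite !ReE ler_pM2r ?invr_gt0 ?ltr0n.
have [y0|] := boolP (0 <= 'Im y); first exact: rootC_Re_max.
rewrite -real_ltNge ?rpred0 ?Creal_Im // => y0.
rewrite -Re_conj; apply: rootC_Re_max => //; first by rewrite -rmorphXn /= ym rmorphN1.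
by rewrite Im_conj oppr_ge0 ltW.
Qed.

(** Solves y + 1/y = t on the unit circle, which supplies explicit roots of -1 to compare with in
    [twocos_ge]. *)
Lemma unit_circle_point (t : algC) : t \is Num.real -> t ^+ 2 <= 4 ->
  exists2 y : algC, y + y^* = t & y ^+ 2 = t * y - 1.
Proof.
move=> tR t4; pose s := sqrtC (4 - t ^+ 2).
have sR : s \is Num.real by rewrite sqrtC_real ?subr_ge0.
have s2 : s ^+ 2 = 4 - t ^+ 2 by apply: sqrtCK.
have i2 : 'i ^+ 2 = -1 :> algC by apply: sqrCi.
exists ((t + 'i * s) / 2).
  rewrite fmorph_div rmorphD rmorphM /= conjCi !conj_Creal // ?rpred_nat //.
  by field.
(* The expected value plus explicit multiples of the relations [i2] and [s2]; later identities use
   the same pattern. *)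
have -> : ((t + 'i * s) / 2) ^+ 2 =
  t * ((t + 'i * s) / 2) - 1 + (('i ^+ 2 + 1) * s ^+ 2 - (s ^+ 2 - (4 - t ^+ 2))) / 4 by field.
by rewrite i2 s2; ring.
Qed.

Lemma sqrt2_sqr : sqrt2 ^+ 2 = 2. Proof. exact: sqrtCK. Qed.
Lemma sqrt5_sqr : sqrt5 ^+ 2 = 5. Proof. exact: sqrtCK. Qed.
Lemma sqrt2_gt0 : 0 < sqrt2. Proof. by rewrite sqrtC_gt0 ltr0n. Qed.
Lemma sqrt5_gt0 : 0 < sqrt5. Proof. by rewrite sqrtC_gt0 ltr0n. Qed.

(** With zw = 1, the sum z^3 + w^3 = -2 is a Chebyshev polynomial in z + w, so [twocos 3] is a root
    of (X + 2)(X - 1)^2; comparison with a root of real part 1/2 excludes -2. *)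
Lemma twocos3 : twocos 3 = 1.
Proof.
have [z [w [c_zw zw z3 w3]]] := @twocos_root 3 isT.
have : twocos 3 ^+ 3 - 3 * twocos 3 + 2 = 0.
  have -> : twocos 3 ^+ 3 - 3 * twocos 3 + 2 =
    (z ^+ 3 + 1) + (w ^+ 3 + 1) + 3 * (z * w - 1) * (z + w) by rewrite c_zw; ring.
  by rewrite zw z3 w3; ring.
have -> : twocos 3 ^+ 3 - 3 * twocos 3 + 2 = (twocos 3 + 2) * (twocos 3 - 1) ^+ 2 by ring.
move/eqP; rewrite mulf_eq0 expf_eq0 /= => /orP[/eqP c2|]; last by rewrite subr_eq0 => /eqP.
have [y yy y2] : exists2 y : algC, y + y^* = 1 & y ^+ 2 = 1 * y - 1.
  by apply: unit_circle_point; rewrite ?rpred1 // expr1n ler1n.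
have y3 : y ^+ 3 = -1 by rewrite exprS y2 mulrBr mul1r -expr2 y2; ring.
have := @twocos_ge 3 y isT y3; rewrite yy => /(lt_le_trans (ltr01)).
by rewrite -[twocos 3](addrK 2) c2 sub0r oppr_gt0 ltrn0.
Qed.

Lemma twocos4 : twocos 4 = sqrt2.
Proof.
have [z [w [c_zw zw z4 w4]]] := @twocos_root 4 isT.
have z1 : `|z| = 1 by apply/eqP; rewrite -(@pexpr_eq1 _ _ 4) // -normrX z4 normrN1.
have z0 : z != 0 by rewrite -normr_eq0 z1 oner_eq0.
have Dw : w = z^*.
  by apply: (mulfI z0); rewrite zw -normCK z1 expr1n.
have c_ge0 : 0 <= twocos 4.
  (* For even exponent -z is a root as well, and maximality of the real part gives the sign. *)
  have zN4 : (- z) ^+ 4 = -1 by rewrite -z4; ring.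
  have := @twocos_ge 4 (- z) isT zN4; rewrite rmorphN /= -opprD -Dw -c_zw => cc.
  by rewrite -(pmulrn_lge0 _ (isT : (0 < 2)%N)) mulr2n -lerBlDr sub0r.
have c4 : (twocos 4 ^+ 2 - 2) ^+ 2 = 0.
  have -> : (twocos 4 ^+ 2 - 2) ^+ 2 =
    (z ^+ 4 + 1) + (w ^+ 4 + 1) + (z * w - 1) * (4 * (z + w) ^+ 2 - 2 * (z * w) - 2).
    by rewrite c_zw; ring.
  by rewrite zw z4 w4; ring.
move/eqP: c4; rewrite expf_eq0 subr_eq0 /= => /eqP c2.
by rewrite -(sqrCK c_ge0) c2.
Qed.

Lemma twocos5 : [/\ twocos 5 ^+ 2 = twocos 5 + 1, 0 < twocos 5 & sqrt5 = 2 * twocos 5 - 1].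
Proof.
have [z [w [c_zw zw z5 w5]]] := @twocos_root 5 isT.
pose t := (1 + sqrt5) / 2.
have t2 : t ^+ 2 = t + 1.
  have -> : t ^+ 2 = t + 1 + (sqrt5 ^+ 2 - 5) / 4 by rewrite /t; field.
  by rewrite sqrt5_sqr subrr mul0r addr0.
have t_gt0 : 0 < t by rewrite divr_gt0 ?ltr0n // addr_gt0 ?ltr01 ?sqrt5_gt0.
have [y yy y2] : exists2 y : algC, y + y^* = t & y ^+ 2 = t * y - 1.
  apply: unit_circle_point; first exact: gtr0_real.
  have -> : t ^+ 2 = 4 - (5 - sqrt5) / 2 by rewrite t2 /t; field.
  rewrite lerBlDr lerDl divr_ge0 ?ler0n // subr_ge0.
  rewrite -[leRHS](@sqrCK _ 5) ?ler0n // ler_sqrtC ?nnegrE ?exprn_ge0 ?ler0n //.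
  by rewrite -natrX ler_nat.
have y5 : y ^+ 5 = -1.
  have -> : y ^+ 5 = -1 + (y ^+ 2 - (t * y - 1)) * (y ^+ 3 + t * y ^+ 2 + (t ^+ 2 - 1) * y + (t ^+ 3 - 2 * t))
    + (t ^+ 2 - (t + 1)) * ((t ^+ 2 + t - 1) * y - (t + 1)) by ring.
  by rewrite y2 t2; ring.
have tc : t <= twocos 5 by have := @twocos_ge 5 y isT y5; rewrite yy.
have c0 : 0 < twocos 5 by apply: lt_le_trans tc.
have : (twocos 5 + 2) * (twocos 5 ^+ 2 - twocos 5 - 1) ^+ 2 = 0.
  have -> : (twocos 5 + 2) * (twocos 5 ^+ 2 - twocos 5 - 1) ^+ 2 =
    twocos 5 ^+ 5 - 5 * twocos 5 ^+ 3 + 5 * twocos 5 + 2 by ring.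
  have -> : twocos 5 ^+ 5 - 5 * twocos 5 ^+ 3 + 5 * twocos 5 + 2 =
    (z ^+ 5 + 1) + (w ^+ 5 + 1) + (z * w - 1) * (5 * (z + w) ^+ 3 - 5 * (z * w) * (z + w) - 5 * (z + w)).
    by rewrite c_zw; ring.
  by rewrite zw z5 w5; ring.
move/eqP; rewrite mulf_eq0 expf_eq0 /= => /orP[/eqP c2|].
  by have := addr_gt0 c0 (ltr0n _ 2); rewrite c2 ltxx.
rewrite -addrA -opprD subr_eq0 => /eqP c2; split=> //.
have -> : sqrt5 = sqrtC ((2 * twocos 5 - 1) ^+ 2).
  congr sqrtC.
  have -> : (2 * twocos 5 - 1) ^+ 2 = 4 * (twocos 5 ^+ 2 - (twocos 5 + 1)) + 5 by ring.
  by rewrite c2 subrr mulr0 add0r.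
rewrite sqrCK // (le_trans (ltW sqrt5_gt0)) //.
have -> : sqrt5 = 2 * t - 1 by rewrite /t; field.
by rewrite lerD2r ler_pM2l ?ltr0n.
Qed.

(** * From norm estimates to degree bounds *)

Section RealLarge.
Variable R : realFieldType.
Implicit Types x y a b phi : R.

Lemma mul_gt0_le x y a b : 0 < x <= a -> 0 < y <= b -> 0 < x * y <= a * b.
Proof.
case/andP=> x0 xa /andP[y0 yb]; rewrite mulr_gt0 //=.
by apply: ler_pM => //; apply: ltW.
Qed.

Lemma identity_range u p q : 2 < u -> u < 14 -> 0 < p -> p <= q ->
  4 <= u ^+ 2 + u * p <= (196 + 14 * q : R).
Proof.
move=> u2 u14 p0 pq; have h1 : 0 <= (14 - u) * (14 + u) by rewrite mulr_ge0; lra.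
have h2 : 0 <= (u - 2) * (u + 2) by rewrite mulr_ge0; lra.
have h3 : 0 <= (14 - u) * p by rewrite mulr_ge0; lra.
have h4 : 0 <= u * p by rewrite mulr_ge0; lra.
by apply/andP; split; lra.
Qed.

(** In each of these estimates the base of the bound dominates every linear factor: 210 = 196 + 14,
    216 = 196 + 20, 225 = 196 + 28 + 1, and rounded values when phi enters. *)
Lemma large33 y : 4 <= y <= 196 + 14 * 1 ->
  0 < y ^+ 3 * (y - 1) ^+ 2 * (y - 2) ^+ 2 * (y ^+ 2 - y - 1) <= 210 ^+ 9.
Proof.
case/andP=> l h.
rewrite (_ : 210 ^+ 9 = (210 ^+ 3) * (210 * 210) * (210 * 210) * (210 * 210)); last by ring.
rewrite (exprS y 2) (exprS 210 2) !expr2.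
have h1 : 0 <= (y - 4) * y by rewrite mulr_ge0; lra.
have h2 : 0 <= (210 - y) * y by rewrite mulr_ge0; lra.
by do !apply: mul_gt0_le; apply/andP; split; lra.
Qed.

Lemma large34 y : 4 <= y <= 196 + 14 * (10 / 7) -> 0 < y ^+ 4 * (y - 1) <= 216 ^+ 5.
Proof.
case/andP=> l h; rewrite [leRHS]exprSr !exprS !expr0 !mulr1.
by do !apply: mul_gt0_le; apply/andP; split; lra.
Qed.

Lemma large44 y : 4 <= y <= 196 + 14 * 2 -> 0 < y * (y + 1) <= 225 ^+ 2.
Proof.
by case/andP=> l h; rewrite [leRHS]expr2; apply: mul_gt0_le; apply/andP; split; lra.
Qed.

Lemma large35 y phi : 4 <= y <= 196 + 14 * (89 / 55) -> phi ^+ 2 = phi + 1 -> 0 < phi ->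
  0 < y * (y - 2 + phi) * (y - 1 + phi) <= 220 ^+ 3.
Proof.
case/andP=> l h e p0; have /andP[_ p1] := golden_pos e p0; clear e.
by rewrite [leRHS]exprSr expr2; do !apply: mul_gt0_le; apply/andP; split; lra.
Qed.

Lemma large45 y phi : 4 <= y <= 196 + 14 * (10 / 7 * (89 / 55)) ->
  phi ^+ 2 = phi + 1 -> 0 < phi -> 0 < y * (y - 1 + phi) * (y + phi) <= 231 ^+ 3.
Proof.
case/andP=> l h e p0; have /andP[_ p1] := golden_pos e p0; clear e.
by rewrite [leRHS]exprSr expr2; do !apply: mul_gt0_le; apply/andP; split; lra.
Qed.

Lemma large55 y phi : 4 <= y <= 196 + 14 * (89 / 55 + 1) -> phi ^+ 2 = phi + 1 -> 0 < phi ->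
  0 < (y - 2 + 2 * phi) * (y + phi) <= 235 ^+ 2.
Proof.
case/andP=> l h e p0; have /andP[_ p1] := golden_pos e p0; clear e.
by rewrite [leRHS]expr2; apply: mul_gt0_le; apply/andP; split; lra.
Qed.

End RealLarge.

Lemma conj_overE t y : conj_over t y =
  [seq r <- conj_over 0 y | conj_aut y r t == t].
Proof.
rewrite /conj_over -filter_predI; apply: eq_filter => r /=.
by rewrite rmorph0 eqxx andbT.
Qed.

(** The norm of w is split into three parts: the identity conjugate, bounded by B; the other
    conjugates fixing t, by [mu1]; those moving t, by [mu2]. *)
Lemma conj_norm_bound (t y w : algC) (B mu1 mu2 : rat) :
  in_Qof y t -> in_Qof y w -> w \in Aint -> w != 0 -> `|w| <= ratr B ->
  (forall nu : autC, nu t = t -> nu y != y -> `|nu w| <= ratr mu1) ->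
  (forall nu : autC, nu t != t -> `|nu w| <= ratr mu2) ->
  1 <= B * mu1 ^+ (size (conj_over t y)).-1 *
       mu2 ^+ (size (conj_over 0 y) - size (conj_over t y)).
Proof.
move=> yt yw wA w0 wB w1 w2.
have := norm_conj_ge1 yw wA w0; rewrite (bigID (fun r => conj_aut y r t == t)) /=.
set s0 := conj_over 0 y; set s := conj_over t y.
rewrite -big_filter -conj_overE -/s.
have ys : y \in s by apply/mem_conj_over => //; exists idfun.
have us : uniq s := conj_over_uniq t y.
rewrite (perm_big _ (perm_to_rem ys)) big_cons => N1.
suff : 1 <= ratr (B * mu1 ^+ (size s).-1 * mu2 ^+ (size s0 - size s)) :> algC.
  by rewrite -(ler_rat algC) rmorph1.
apply: le_trans N1 _; rewrite !rmorphM !rmorphXn.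
have prod_le (l : seq algC) (P : pred algC) (mu : algC) :
    (forall r, r \in l -> P r -> `|conj_aut y r w| <= mu) ->
    0 <= \prod_(r <- l | P r) `|conj_aut y r w| <= mu ^+ count P l.
  move=> le_mu; apply/andP; split; first by apply: prodr_ge0.
  have -> : mu ^+ count P l = \prod_(r <- l | P r) mu.
    by rewrite big_const_seq iter_mulr_1.
  by rewrite big_seq_cond [leRHS]big_seq_cond; apply: ler_prod => r /andP[? ?]; rewrite normr_ge0 le_mu.
have y0 : in_Qof y 0 by move=> nu _; rewrite rmorph0.
have /andP[p1 q1] : 0 <= \prod_(r <- rem y s) `|conj_aut y r w| <= ratr mu1 ^+ (size s).-1.
  rewrite -(size_rem ys) -(count_predT (rem y s)); apply: prod_le => r.
  rewrite mem_rem_uniq // inE => /andP[ry /(mem_conj_over _ yt)[nu nut Dr]] _.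
  by rewrite -Dr (conj_aut_in_Qof nu yw); apply: w1 => //; rewrite Dr.
have /andP[p2 q2] : 0 <= \prod_(r <- s0 | conj_aut y r t != t) `|conj_aut y r w| <=
    ratr mu2 ^+ (size s0 - size s).
  have -> : (size s0 - size s)%N = count (fun r => conj_aut y r t != t) s0.
    have Ds : size s = count (fun r => conj_aut y r t == t) s0.
      by rewrite /s conj_overE size_filter.
    by rewrite Ds -(count_predC (fun r => conj_aut y r t == t) s0) addKn.
  by apply: prod_le => r _; apply: w2.
rewrite ler_pM ?mulr_ge0 ?normr_ge0 // ler_pM ?normr_ge0 //.
suff -> : conj_aut y y w = w by [].
exact: (conj_aut_in_Qof idfun yw).
Qed.

(** The exponent n - n is the shape of [conj_norm_bound] for t = 0, where no conjugate moves t. *)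
Lemma degree_bound_Q (B mu mu2 : rat) n D : 0 < B -> 0 <= mu <= 1 -> B * mu ^+ D < 1 ->
  1 <= B * mu ^+ n.-1 * mu2 ^+ (n - n) -> (n <= D)%N.
Proof.
move=> B0 /andP[mu0 mu1] BD; rewrite subnn expr0 mulr1 leqNgt => Bn; apply/negP => Dn.
have : B * mu ^+ n.-1 <= B * mu ^+ D.
  by rewrite ler_pM2l // ler_wiXn2l // -ltnS prednK // (leq_ltn_trans _ Dn).
by move/(le_trans Bn)/le_lt_trans/(_ BD); rewrite ltxx.
Qed.

(** Raising m by one multiplies the bound by mu1 * mu2 <= 1, so failure at m = D + 1 persists. The
    exponents D and D + 1 differ because B accounts for the identity conjugate. *)
Lemma degree_bound_quad (B mu1 mu2 : rat) m D : 0 < B -> 0 <= mu1 -> 0 <= mu2 ->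
  mu1 * mu2 <= 1 -> B * mu1 ^+ D * mu2 ^+ D.+1 < 1 ->
  1 <= B * mu1 ^+ m.-1 * mu2 ^+ (m.*2 - m) -> (m <= D)%N.
Proof.
move=> B0 mu10 mu20 mu12 BD; rewrite -addnn addnK leqNgt => Bm; apply/negP => Dm.
have Em : m = (D.+1 + (m - D.+1))%N by rewrite subnKC.
move: Bm; rewrite Em addSn /= -addSn !exprD => Bm.
set j := (m - D.+1)%N in Bm.
suff : B * (mu1 ^+ D * mu1 ^+ j) * (mu2 ^+ D.+1 * mu2 ^+ j) <= B * mu1 ^+ D * mu2 ^+ D.+1.
  by move/(le_trans Bm)/le_lt_trans/(_ BD); rewrite ltxx.
have -> : B * (mu1 ^+ D * mu1 ^+ j) * (mu2 ^+ D.+1 * mu2 ^+ j) =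
  B * mu1 ^+ D * mu2 ^+ D.+1 * (mu1 * mu2) ^+ j by rewrite exprMn; ring.
by rewrite ler_piMr ?mulr_ge0 ?exprn_ge0 ?(ltW B0) // exprn_ile1 ?mulr_ge0.
Qed.

(** * V-arithmetic matrices of order three *)

Lemma map_Amat (nu : autC) u c d : map_mx nu (Amat u c d) = Amat (nu u) (nu c) (nu d).
Proof.
apply/matrixP => i j; rewrite !mxE.
by case: i => [[|[|[|?]]] //= ?]; case: j => [[|[|[|?]]] //= ?]; rewrite ?rmorphN ?rmorph_nat.
Qed.

Lemma quadform_Amat (a c d x1 x2 x3 : algC) (v : 'rV[algC]_3) :
  v = \row_j nth 0 [:: x1; x2; x3] j ->
  (v *m Amat a c d *m v^T) 0 0 =
  - 2 * (x1 ^+ 2 + x2 ^+ 2 + x3 ^+ 2) + 2 * (a * x1 * x2 + c * x1 * x3 + d * x2 * x3).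
Proof.
move=> ->; rewrite !mxE !big_ord_recl big_ord0 !mxE !big_ord_recl !big_ord0 !mxE /=.
ring.
Qed.

(** The conclusion says that the determinant is negative. The vectors (1, 1, 0) and (1, -1, 0) first
    give a^2 < 4. *)
Lemma neg_definite_Amat (a c d : algC) : a \is Num.real -> c \is Num.real -> d \is Num.real ->
  neg_definite (Amat a c d) -> a ^+ 2 + c ^+ 2 + d ^+ 2 + a * c * d < 4.
Proof.
move=> aR cR dR neg.
have form x1 x2 x3 : x1 \is Num.real -> x2 \is Num.real -> x3 \is Num.real ->
    [|| x1 != 0, x2 != 0 | x3 != 0] ->
    - 2 * (x1 ^+ 2 + x2 ^+ 2 + x3 ^+ 2) + 2 * (a * x1 * x2 + c * x1 * x3 + d * x2 * x3) < 0.
  move=> x1R x2R x3R nz; pose v : 'rV[algC]_3 := \row_j nth 0 [:: x1; x2; x3] j.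
  rewrite -(quadform_Amat a c d (erefl v)); apply: neg => [i|].
    by rewrite mxE; case: i => [[|[|[|?]]] ?].
  apply: contraTneq nz => /rowP v0.
  have := v0 0; have := v0 1; have := v0 2%:R; rewrite !mxE /= => -> -> ->.
  by rewrite eqxx.
have a_lt : 0 < 4 - a ^+ 2.
  have e1 := form 1 1 0 (rpred1 _) (rpred1 _) (rpred0 _).
  have e2 := form 1 (-1) 0 (rpred1 _) (rpredN1 _) (rpred0 _).
  have -> : 4 - a ^+ 2 = (2 - a) * (2 + a) by ring.
  apply: mulr_gt0; rewrite -(pmulr_rgt0 _ (ltr0n _ 2)) -oppr_lt0.
    by rewrite (_ : - (2 * _) = - 2 * (1 ^+ 2 + 1 ^+ 2 + 0 ^+ 2) + 2 * (a * 1 * 1 + c * 1 * 0 + d * 1 * 0)) ?e1 ?oner_eq0 //; ring.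
  by rewrite (_ : - (2 * _) = - 2 * (1 ^+ 2 + (-1) ^+ 2 + 0 ^+ 2) + 2 * (a * 1 * (-1) + c * 1 * 0 + d * (-1) * 0)) ?e2 ?oner_eq0 //; ring.
have r2 : (2 : algC) \is Num.real by apply: realn.
(* The last row of the adjugate matrix, so that the form evaluates to
   (4 - a ^+ 2) times the determinant. *)
have x1R : a * d + 2 * c \is Num.real by apply: rpredD; apply: rpredM.
have x2R : a * c + 2 * d \is Num.real by apply: rpredD; apply: rpredM.
have := form _ _ _ x1R x2R (gtr0_real a_lt).
rewrite (gt_eqF a_lt) !orbT => /(_ isT).
rewrite (_ : _ + _ = 2 * (4 - a ^+ 2) * (a ^+ 2 + c ^+ 2 + d ^+ 2 + a * c * d - 4)); last by ring.
by rewrite pmulr_rlt0 ?subr_lt0 // mulr_gt0.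
Qed.

Section VArithmetic.
Variables u c d : algC.
Hypothesis VA : V_arithmetic (Amat u c d).
Hypotheses (u_gt2 : 2 < u) (c_gt0 : 0 < c) (d_gt0 : 0 < d).
Let A := Amat u c d.
Let K := ground_field A.
Let y := u ^+ 2 + u * (c * d).

Let i0 : 'I_3 := @Ordinal 3 0 isT.
Let i1 : 'I_3 := @Ordinal 3 1 isT.
Let i2 : 'I_3 := @Ordinal 3 2 isT.

Lemma cyc_prod2 i j : is_cyc_prod A (A i j * A j i).
Proof. by exists i, [:: j]; rewrite /cyc_prod /= !big_ord_recl big_ord0 mulr1. Qed.

Lemma cyc_u2 : is_cyc_prod A (u ^+ 2).
Proof. by have := cyc_prod2 i0 i1; rewrite !mxE. Qed.

Lemma cyc_d2 : is_cyc_prod A (d ^+ 2).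
Proof. by have := cyc_prod2 i1 i2; rewrite !mxE. Qed.

Lemma cyc_ucd : is_cyc_prod A (u * (c * d)).
Proof.
exists i0, [:: i1; i2]; rewrite /cyc_prod /= !big_ord_recl big_ord0 mulr1 !mxE /=.
by rewrite [d * c]mulrC.
Qed.

Lemma ground_field_y : K y.
Proof.
exact: (subfieldD (@gen_field_subfield _) (gen_field_gen cyc_u2) (gen_field_gen cyc_ucd)).
Qed.

Lemma Aint_cyc x : is_cyc_prod A x -> x \in Aint.
Proof. by have [_ _ cA _ _] := VA; apply: cA. Qed.

Lemma Aint_y : y \in Aint.
Proof. by rewrite rpredD ?Aint_cyc //; [apply: cyc_u2 | apply: cyc_ucd]. Qed.

Lemma entry_real (nu : autC) i j : nu (A i j) \is Num.real.
Proof.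
have [_ _ _ tr _] := VA; apply: tr.
by apply: gen_field_gen; exists i, j.
Qed.

Lemma conj_range (nu : autC) : (exists2 x, K x & nu x != x) ->
  [/\ nu y \is Num.real, - (nu (c ^+ 2) * nu (d ^+ 2)) / 4 <= nu y &
      nu y < 4 - nu (c ^+ 2) - nu (d ^+ 2)].
Proof.
move=> neq; have [_ _ _ _ negA] := VA; have := negA nu neq; rewrite map_Amat.
have := entry_real nu i0 i1; have := entry_real nu i0 i2; have := entry_real nu i1 i2.
rewrite !mxE /= => dR cR uR /(neg_definite_Amat uR cR dR) det.
have -> : nu y = nu u ^+ 2 + nu u * (nu c * nu d) by rewrite rmorphD rmorphXn !rmorphM.
rewrite !rmorphXn; split.
- by rewrite rpredD ?rpredM ?rpredX.
- rewrite -subr_ge0.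
  have -> : nu u ^+ 2 + nu u * (nu c * nu d) - - (nu c ^+ 2 * nu d ^+ 2) / 4 =
    (nu u + nu c * nu d / 2) ^+ 2 by field.
  by rewrite real_exprn_even_ge0 // rpredD // rpred_div ?rpredM ?realn.
- rewrite -subr_gt0 in det; rewrite -subr_gt0; move: det; congr (0 < _); ring.
Qed.

Lemma ground_field_in_Qof x : K x <-> in_Qof y x.
Proof.
split=> [Kx nu nuy|]; last by move=> yx; exact: (subfield_Qof (@gen_field_subfield _) ground_field_y yx).
apply/eqP/negPn/negP => nux.
have [_ _] := conj_range (ex_intro2 _ _ x Kx nux).
have cR := entry_real nu i0 i2; have dR := entry_real nu i1 i2.
rewrite !mxE /= in cR dR.
have y_ge4 : 4 <= y.
  have u0 : 0 < u by rewrite (lt_trans _ u_gt2) ?ltr0n.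
  have -> : 4 = 2 ^+ 2 :> algC by ring.
  apply: (ler_wpDr (ltW (mulr_gt0 u0 (mulr_gt0 c_gt0 d_gt0)))).
  by rewrite ler_pXn2r ?nnegrE ?ler0n ?ltW.
rewrite nuy !rmorphXn => /(le_lt_trans y_ge4).
rewrite -addrA -opprD ltrDl oppr_gt0 => /lt_geF.
by rewrite addr_ge0 // real_exprn_even_ge0.
Qed.

Lemma conj_range_neq (nu : autC) : nu y != y ->
  [/\ nu y \is Num.real, - (nu (c ^+ 2) * nu (d ^+ 2)) / 4 <= nu y &
      nu y < 4 - nu (c ^+ 2) - nu (d ^+ 2)].
Proof. by move=> nuy; apply: conj_range; exists y => //; apply: ground_field_y. Qed.

End VArithmetic.

(** * Automorphisms acting on sqrt2 and sqrt5 *)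

Definition rmE := (rmorph_nat, rmorph1, rmorphXn, rmorphN, rmorphD, rmorphM, fmorphV).

Lemma algR_le (a b : algR) : (algRval a <= algRval b) = (a <= b).
Proof. by []. Qed.

Lemma algR_lt (a b : algR) : (algRval a < algRval b) = (a < b).
Proof. by []. Qed.

Lemma algR_lift (x : algC) : x \is Num.real -> exists x0 : algR, x = algRval x0.
Proof. by move=> xR; exists (in_algR xR). Qed.

Lemma sqrt_not_Crat (n : nat) (x : algC) : (forall m : nat, m * m != n)%N ->
  x ^+ 2 = n%:R -> x \notin Crat.
Proof.
move=> nsq x2; apply/negP => xQ.
have xA : x \in Aint.
  apply: (@root_monic_Aint ('X^2 - n%:R%:P)).
  - by rewrite rootE !hornerE x2 subrr.
  - by rewrite monicE lead_coefDl ?lead_coefXn // size_polyXn size_polyN size_polyC; case: eqP.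
  - apply/polyOverP => i; rewrite coefB coefXn coefC.
    by apply: rpredB; rewrite ?rpred_nat //; case: (i == 0%N); rewrite ?rpred0 ?rpred_nat.
have /natrP[m Dm] : `|x| \is a Num.nat by apply: natr_norm_int; apply: Cint_rat_Aint.
have /eqP : (m * m)%:R = n%:R :> algC by rewrite natrM -Dm -normrM -expr2 x2 normr_nat.
by rewrite eqr_nat (negPf (nsq m)).
Qed.

(** The finite list of conjugates of x makes the search for a moving automorphism decidable. *)
Lemma exists_aut_neq (x : algC) : x \notin Crat -> exists nu : autC, nu x != x.
Proof.
have x0 : in_Qof x 0 by move=> nu _; rewrite rmorph0.
have [/allP all_x|/allPn[r /(mem_conj_over _ x0)[nu _ <-]]] :=
  boolP (all (pred1 x) (conj_over 0 x)); last by exists nu.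
case/negP; apply: fixed_Crat => nu.
by apply/eqP/all_x/mem_conj_over => //; exists nu; rewrite ?rmorph0.
Qed.

Lemma aut_sqrt (nu : autC) (x : algC) n : x ^+ 2 = n%:R -> nu x = x \/ nu x = - x.
Proof.
move=> x2; have /eqP : nu x ^+ 2 = x ^+ 2 by rewrite -rmorphXn x2 rmorph_nat.
by rewrite eqf_sqr => /orP[] /eqP ->; [left | right].
Qed.

Lemma nonsquare (m : nat) : [&& m * m != 2, m * m != 5 & m * m != 10]%N.
Proof.
case: (ltnP m 4) => [|m4]; first by case: m => [|[|[|[|?]]]].
have := leq_mul m4 m4; by apply: contraTT; rewrite !negb_and !negbK => /or3P[] /eqP ->.
Qed.

Lemma exists_aut_sqrt5 : exists nu : autC, nu sqrt5 = - sqrt5.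
Proof.
have nQ : sqrt5 \notin Crat.
  by apply: (@sqrt_not_Crat 5) sqrt5_sqr => m; case/and3P: (nonsquare m).
have [nu nu5] := exists_aut_neq nQ; exists nu.
by case: (aut_sqrt nu sqrt5_sqr) nu5 => // ->; rewrite eqxx.
Qed.

(* The sign pairs on (sqrt2, sqrt5) realized by automorphisms form a subgroup
   of {1, -1}^2 which lies in none of the three subgroups of index 2, because
   sqrt2, sqrt5 and sqrt2 * sqrt5 are irrational. *)
Lemma exists_aut_sqrt2 : exists2 nu : autC, nu sqrt2 = - sqrt2 & nu sqrt5 = sqrt5.
Proof.
have n2 : sqrt2 \notin Crat.
  by apply: (@sqrt_not_Crat 2) sqrt2_sqr => m; case/and3P: (nonsquare m).
have n10 : sqrt2 * sqrt5 \notin Crat.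
  apply: (@sqrt_not_Crat 10) => [m|]; first by case/and3P: (nonsquare m).
  by rewrite exprMn sqrt2_sqr sqrt5_sqr -natrM.
have [a a2] := exists_aut_neq n2.
have Da2 : a sqrt2 = - sqrt2.
  by case: (aut_sqrt a sqrt2_sqr) a2 => // ->; rewrite eqxx.
have [Da5|Da5] := aut_sqrt a sqrt5_sqr; first by exists a.
have [b b10] := exists_aut_neq n10; rewrite rmorphM in b10.
have [b2|b2] := aut_sqrt b sqrt2_sqr; have [b5|b5] := aut_sqrt b sqrt5_sqr.
- by rewrite b2 b5 eqxx in b10.
- by exists (b \o a); rewrite /= ?Da2 ?Da5 rmorphN ?b2 ?b5 ?opprK.
- by exists b.
- by rewrite b2 b5 mulrNN eqxx in b10.
Qed.

(** * Degrees over Q *)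

Section NormBound.
Variable w : forall R : comNzRingType, R -> R -> R.
Hypothesis w_rmorph : forall (R S : comNzRingType) (f : {rmorphism R -> S}) x z,
  f (w x z) = w (f x) (f z).
Hypothesis w_Aint : forall x z, x \in Aint -> z \in Aint -> w x z \in Aint.

(** The order on [algC] is partial, so the estimates take place in [algR]. The polynomial is given
    over all rings at once in order to commute with [algRval] and with automorphisms. *)
Lemma w_norm_bound (y phi t : algC) (B mu1 mu2 : rat) :
  y \in Aint -> phi \in Aint -> in_Qof y t -> in_Qof y phi ->
  (exists y0 phi0 : algR, [/\ y = algRval y0, phi = algRval phi0 & 0 < w y0 phi0 <= ratr B]) ->
  (forall nu : autC, nu t = t -> nu y != y -> exists y0 phi0 : algR,
     [/\ nu y = algRval y0, nu phi = algRval phi0 & `|w y0 phi0| <= ratr mu1]) ->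
  (forall nu : autC, nu t != t -> exists y0 phi0 : algR,
     [/\ nu y = algRval y0, nu phi = algRval phi0 & `|w y0 phi0| <= ratr mu2]) ->
  1 <= B * mu1 ^+ (size (conj_over t y)).-1 *
       mu2 ^+ (size (conj_over 0 y) - size (conj_over t y)).
Proof.
move=> yA phiA yt yphi [y0 [phi0 [Dy Dphi /andP[w0 wB]]]] w1 w2.
have norm_le (x z : algR) (b : rat) :
    `|w x z| <= ratr b -> `|w (algRval x) (algRval z)| <= ratr b.
  by rewrite -w_rmorph -(fmorph_rat algRval) => h; exact: h.
apply: (@conj_norm_bound t y (w y phi)) => //.
- by move=> nu nuy; rewrite w_rmorph nuy (yphi nu nuy).
- exact: w_Aint.
- by rewrite Dy Dphi -w_rmorph fmorph_eq0 gt_eqF.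
- by rewrite Dy Dphi; apply: norm_le; rewrite gtr0_norm.
- move=> nu nut nuy; have [x [z [Dx Dz h]]] := w1 nu nut nuy.
  by rewrite w_rmorph Dx Dz; apply: norm_le.
- move=> nu nut; have [x [z [Dx Dz h]]] := w2 nu nut.
  by rewrite w_rmorph Dx Dz; apply: norm_le.
Qed.

End NormBound.

(* phi stands for the golden ratio or its conjugate; it is a dummy argument of
   the first three polynomials. *)
Definition w33 (R : comNzRingType) (y phi : R) : R :=
  y ^+ 3 * (y - 1) ^+ 2 * (y - 2) ^+ 2 * (y ^+ 2 - y - 1).
Definition w34 (R : comNzRingType) (y phi : R) : R := y ^+ 4 * (y - 1).
Definition w44 (R : comNzRingType) (y phi : R) : R := y * (y + 1).
(** For both signs of phi all three roots lie in the interval, and 2 - phi is its right end. *)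
Definition w35 (R : comNzRingType) (y phi : R) : R :=
  y * (y - 2 + phi) * (y - 1 + phi).
Definition w45 (R : comNzRingType) (y phi : R) : R :=
  y * (y - 1 + phi) * (y + phi).
(** The roots are the right end 2 - 2 phi of the interval and the interior point - phi. *)
Definition w55 (R : comNzRingType) (y phi : R) : R :=
  (y - 2 + 2 * phi) * (y + phi).

Lemma w33_rmorph (R S : comNzRingType) (f : {rmorphism R -> S}) x z :
  f (w33 x z) = w33 (f x) (f z).
Proof. by rewrite /w33 !rmE. Qed.

Lemma w34_rmorph (R S : comNzRingType) (f : {rmorphism R -> S}) x z :
  f (w34 x z) = w34 (f x) (f z).
Proof. by rewrite /w34 !rmE. Qed.

Lemma w44_rmorph (R S : comNzRingType) (f : {rmorphism R -> S}) x z :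
  f (w44 x z) = w44 (f x) (f z).
Proof. by rewrite /w44 !rmE. Qed.

Lemma w35_rmorph (R S : comNzRingType) (f : {rmorphism R -> S}) x z :
  f (w35 x z) = w35 (f x) (f z).
Proof. by rewrite /w35 !rmE. Qed.

Lemma w45_rmorph (R S : comNzRingType) (f : {rmorphism R -> S}) x z :
  f (w45 x z) = w45 (f x) (f z).
Proof. by rewrite /w45 !rmE. Qed.

Lemma w55_rmorph (R S : comNzRingType) (f : {rmorphism R -> S}) x z :
  f (w55 x z) = w55 (f x) (f z).
Proof. by rewrite /w55 !rmE. Qed.

Lemma w33_Aint x z : x \in Aint -> z \in Aint -> w33 x z \in Aint.
Proof. by move=> xA zA; rewrite /w33 !(rpredM, rpredX, rpredB, rpredD, rpred_nat, rpred1). Qed.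

Lemma w34_Aint x z : x \in Aint -> z \in Aint -> w34 x z \in Aint.
Proof. by move=> xA zA; rewrite /w34 !(rpredM, rpredX, rpredB, rpredD, rpred_nat, rpred1). Qed.

Lemma w44_Aint x z : x \in Aint -> z \in Aint -> w44 x z \in Aint.
Proof. by move=> xA zA; rewrite /w44 !(rpredM, rpredX, rpredB, rpredD, rpred_nat, rpred1). Qed.

Lemma w35_Aint x z : x \in Aint -> z \in Aint -> w35 x z \in Aint.
Proof. by move=> xA zA; rewrite /w35 !(rpredM, rpredX, rpredB, rpredD, rpred_nat, rpred1). Qed.

Lemma w45_Aint x z : x \in Aint -> z \in Aint -> w45 x z \in Aint.
Proof. by move=> xA zA; rewrite /w45 !(rpredM, rpredX, rpredB, rpredD, rpred_nat, rpred1). Qed.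

Lemma w55_Aint x z : x \in Aint -> z \in Aint -> w55 x z \in Aint.
Proof. by move=> xA zA; rewrite /w55 !(rpredM, rpredX, rpredB, rpredD, rpred_nat, rpred1). Qed.

Lemma conj_lift u c d (nu : autC) (C0 D0 : algR) : V_arithmetic (Amat u c d) ->
  nu (c ^+ 2) = algRval C0 -> nu (d ^+ 2) = algRval D0 ->
  let y := u ^+ 2 + u * (c * d) in nu y != y ->
  exists y0 : algR, [/\ nu y = algRval y0, - (C0 * D0) / 4 <= y0 & y0 <= 4 - C0 - D0].
Proof.
move=> VA EC ED y nuy; have [yR l h] := conj_range_neq VA nuy.
have [y0 Dy] := algR_lift yR; exists y0; split=> //; rewrite -algR_le !rmE /= -Dy -EC -ED //.
exact: ltW.
Qed.

Lemma identity_lift u p (p0 q : algR) : 2 < u -> u < 14 -> p = algRval p0 -> 0 < p0 -> p0 <= q ->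
  exists y0 : algR, u ^+ 2 + u * p = algRval y0 /\ 4 <= y0 <= 196 + 14 * q.
Proof.
move=> u2 u14 -> p00 pq.
have [u0 Du] := algR_lift (gtr0_real (lt_trans (ltr0n _ 2) u2)).
exists (u0 ^+ 2 + u0 * p0); rewrite !rmE /= -Du; split=> //.
by apply: identity_range; rewrite -?algR_lt ?rmE /= -?Du.
Qed.

Section QCase.
Variables (u c d : algC) (m n D : nat) (p0 q : algR) (B mu : rat).
Variable w : forall R : comNzRingType, R -> R -> R.
Hypothesis w_rmorph : forall (R S : comNzRingType) (f : {rmorphism R -> S}) x z,
  f (w x z) = w (f x) (f z).
Hypothesis w_Aint : forall x z, x \in Aint -> z \in Aint -> w x z \in Aint.
Hypotheses (VA : V_arithmetic (Amat u c d)) (u2 : 2 < u) (u14 : u < 14).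
Hypotheses (Dc : c ^+ 2 = m%:R) (Dd : d ^+ 2 = n%:R) (c_gt0 : 0 < c) (d_gt0 : 0 < d).
Hypotheses (Dp : c * d = algRval p0) (p0_gt0 : 0 < p0) (p0_le : p0 <= q).
Hypothesis large : forall y : algR, 4 <= y <= 196 + 14 * q -> 0 < w y 0 <= ratr B.
Hypothesis small : forall y : algR, - (m%:R * n%:R) / 4 <= y -> y <= 4 - m%:R - n%:R ->
  `|w y 0| <= ratr mu.
Hypotheses (B_gt0 : 0 < B) (mu01 : 0 <= mu <= 1) (BD : B * mu ^+ D < 1).

Lemma QCase_degree : degree_le Qfield (ground_field (Amat u c d)) D.
Proof.
pose y := u ^+ 2 + u * (c * d).
have Q0 : in_Qof y 0 by move=> nu _; rewrite rmorph0.
have QE x : Qfield x <-> in_Qof 0 x.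
  by apply: gen_field_Qof => //; apply: subfield0; apply: gen_field_subfield.
exists (size (conj_over 0 y)).
  by apply: field_degree_conj => // x; apply: ground_field_in_Qof.
(* Over Q no automorphism moves the base point 0; the value 1 is a placeholder for [mu2]. *)
apply: (@degree_bound_Q B mu 1) => //.
apply: (w_norm_bound w_rmorph w_Aint (phi := 0)) => //; first exact: Aint_y.
- have [y0 [Dy ly]] := identity_lift u2 u14 Dp p0_gt0 p0_le.
  by exists y0, 0; split; rewrite ?rmorph0 //; apply: large.
- move=> nu _ nuy.
  have nuc : nu (c ^+ 2) = algRval m%:R by rewrite Dc !rmorph_nat.
  have nud : nu (d ^+ 2) = algRval n%:R by rewrite Dd !rmorph_nat.
  have [y0 [Dy l h]] := conj_lift VA nuc nud nuy.
  by exists y0, 0; split; rewrite ?rmorph0 //; apply: small.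
- by move=> nu; rewrite rmorph0 eqxx.
Qed.

End QCase.

(** The origin of the degree bound: 23 is the least exponent that brings this product below 1. *)
Lemma numerics33 : (0 < 210 ^+ 9 :> rat) /\ (210 ^+ 9 * (12 / 100) ^+ 23 < 1 :> rat).
Proof. by split; lra. Qed.

Lemma degree_case33 u : 2 < u -> u < 14 -> V_arithmetic (Amat u (twocos 3) (twocos 3)) ->
  degree_le Qfield (ground_field (Amat u (twocos 3) (twocos 3))) 23.
Proof.
rewrite twocos3 => u2 u14 VA; have [B_gt0 BD] := numerics33.
have mu01 : 0 <= (12 / 100 : rat) <= 1 by lra.
have one2 : 1 ^+ 2 = 1%:R :> algC by rewrite expr1n.
have Dp : 1 * 1 = algRval 1 by rewrite mulr1 rmorph1.
apply: (QCase_degree w33_rmorph w33_Aint VA u2 u14 one2 one2 ltr01 ltr01 Dp ltr01 (lexx _) _ _ B_gt0 mu01 BD).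
- by move=> y ly; rewrite rmorphXn rmorph_nat; exact: large33.
- by move=> y l h; rewrite fmorph_div !rmorph_nat; exact: bound33.
Qed.

Lemma sqrt2_lift : exists s0 : algR, [/\ sqrt2 = algRval s0, s0 ^+ 2 = 2 & 0 < s0 <= 10 / 7].
Proof.
have [s0 Ds] := algR_lift (gtr0_real sqrt2_gt0).
have s2 : s0 ^+ 2 = 2.
  by apply: (fmorph_inj algRval); rewrite !rmE /= -Ds sqrt2_sqr.
have s_gt0 : 0 < s0 by rewrite -algR_lt -Ds sqrt2_gt0.
by exists s0; split=> //; rewrite s_gt0 sqrt2_le.
Qed.

Lemma numerics34 : (0 < 216 ^+ 5 :> rat) /\ (216 ^+ 5 * (47 / 500) ^+ 12 < 1 :> rat).
Proof. by split; lra. Qed.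

Lemma degree_case34 u : 2 < u -> u < 14 -> V_arithmetic (Amat u (twocos 3) (twocos 4)) ->
  degree_le Qfield (ground_field (Amat u (twocos 3) (twocos 4))) 12.
Proof.
rewrite twocos3 twocos4 => u2 u14 VA; have [s0 [Ds s2 /andP[s_gt0 s_le]]] := sqrt2_lift.
have [B_gt0 BD] := numerics34.
have mu01 : 0 <= (47 / 500 : rat) <= 1 by lra.
have one2 : 1 ^+ 2 = 1%:R :> algC by rewrite expr1n.
have Dp : 1 * sqrt2 = algRval s0 by rewrite mul1r.
apply: (QCase_degree w34_rmorph w34_Aint VA u2 u14 one2 sqrt2_sqr ltr01 sqrt2_gt0 Dp s_gt0 s_le _ _ B_gt0 mu01 BD).
- by move=> y ly; rewrite rmorphXn rmorph_nat; exact: large34.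
- by move=> y l h; rewrite fmorph_div !rmorph_nat; exact: bound34.
Qed.

Lemma numerics44 : (0 < 225 ^+ 2 :> rat) /\ (225 ^+ 2 * (1 / 4) ^+ 8 < 1 :> rat).
Proof. by split; lra. Qed.

Lemma degree_case44 u : 2 < u -> u < 14 -> V_arithmetic (Amat u (twocos 4) (twocos 4)) ->
  degree_le Qfield (ground_field (Amat u (twocos 4) (twocos 4))) 8.
Proof.
rewrite twocos4 => u2 u14 VA; have [B_gt0 BD] := numerics44.
have mu01 : 0 <= (1 / 4 : rat) <= 1 by lra.
have Dp : sqrt2 * sqrt2 = algRval 2 by rewrite -expr2 sqrt2_sqr rmorph_nat.
apply: (QCase_degree w44_rmorph w44_Aint VA u2 u14 sqrt2_sqr sqrt2_sqr sqrt2_gt0 sqrt2_gt0 Dp (ltr0n _ 2) (lexx _) _ _ B_gt0 mu01 BD).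
- by move=> y ly; rewrite rmorphXn rmorph_nat; exact: large44.
- by move=> y l h; rewrite fmorph_div rmorph1 rmorph_nat; exact: bound44.
Qed.

(** * Degrees over Q(sqrt5) *)

Lemma golden_compl (R : realFieldType) (phi : R) : phi ^+ 2 = phi + 1 -> 0 < phi ->
  (1 - phi) ^+ 2 = (1 - phi) + 1 /\ 1 - phi < 0.
Proof.
move=> e p; have /andP[l _] := golden_pos e p; split; last by lra.
by rewrite sqrrB e expr1n; ring.
Qed.

Lemma gt0_oppr_neq (x : algC) : 0 < x -> - x != x.
Proof. by move=> x0; rewrite eqNr gt_eqF. Qed.

Lemma twocos5_lift : exists phi0 : algR,
  [/\ twocos 5 = algRval phi0, phi0 ^+ 2 = phi0 + 1 & 0 < phi0].
Proof.
have [e p _] := twocos5; have [phi0 D0] := algR_lift (gtr0_real p).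
exists phi0; split=> //; last by rewrite -algR_lt -D0.
by apply: (fmorph_inj algRval); rewrite rmorphXn rmorphD rmorph1 /= -D0.
Qed.

Lemma twocos5_conj (nu : autC) : exists phi0 : algR,
  [/\ nu (twocos 5) = algRval phi0, phi0 ^+ 2 = phi0 + 1,
      nu sqrt5 = sqrt5 -> 0 < phi0 & nu sqrt5 != sqrt5 -> phi0 < 0].
Proof.
have [_ _ D5] := twocos5; have [phi [Dphi e p]] := twocos5_lift.
have Dnu : nu (twocos 5) = (nu sqrt5 + 1) / 2.
  by rewrite D5 rmorphB rmorphM rmorph1 rmorph_nat; field.
have Dt : twocos 5 = (sqrt5 + 1) / 2 by rewrite D5; field.
have [n5|n5] := aut_sqrt nu sqrt5_sqr; rewrite n5.
  exists phi; split; rewrite ?eqxx // Dnu n5 -Dt //.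
have [e' p'] := golden_compl e p; exists (1 - phi); split=> //.
  by rewrite Dnu n5 rmorphB rmorph1 /= -Dphi Dt; field.
by move/eqP; rewrite (negPf (gt0_oppr_neq sqrt5_gt0)).
Qed.

Lemma Qsqrt5_in_Qof x : Qsqrt5 x <-> in_Qof sqrt5 x.
Proof. by apply: gen_field_Qof => [_ -> //|]; apply: gen_field_gen. Qed.

Lemma Qfield_in_Qof x : Qfield x <-> in_Qof 0 x.
Proof. by apply: gen_field_Qof => //; apply: subfield0; apply: gen_field_subfield. Qed.

Lemma size_conj_sqrt5 y : in_Qof y sqrt5 ->
  size (conj_over 0 y) = (size (conj_over sqrt5 y)).*2.
Proof.
move=> y5; have [tau t5] := exists_aut_sqrt5.
apply: (@conj_over_double 0 sqrt5 y tau) => //; rewrite ?rmorph0 //.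
- by move=> nu _; rewrite rmorph0.
- by rewrite t5 gt0_oppr_neq ?sqrt5_gt0.
- by rewrite t5 rmorphN t5 opprK.
- by move=> nu _; rewrite t5; apply: aut_sqrt sqrt5_sqr.
Qed.

(** [conj_over] takes a single generator, whence the primitive element sqrt2 + sqrt5: any sign
    change other than the identity alters the sum. *)
Lemma in_Qof_sqrt2_sqrt5 :
  in_Qof (sqrt2 + sqrt5) sqrt2 /\ in_Qof (sqrt2 + sqrt5) sqrt5.
Proof.
suff h2 : in_Qof (sqrt2 + sqrt5) sqrt2.
  split=> // nu nut; have n2 := h2 nu nut.
  by move: nut; rewrite rmorphD n2 => /addrI.
move=> nu; rewrite rmorphD.
have [-> //|->] := aut_sqrt nu sqrt2_sqr; have [->|->] := aut_sqrt nu sqrt5_sqr.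
  by move/addIr.
have s0 : 0 < sqrt2 + sqrt5 by rewrite addr_gt0 ?sqrt2_gt0 ?sqrt5_gt0.
by rewrite -opprD => /eqP; rewrite (negPf (gt0_oppr_neq s0)).
Qed.

Lemma Qsqrt2sqrt5_in_Qof x : Qsqrt2sqrt5 x <-> in_Qof (sqrt2 + sqrt5) x.
Proof.
have [q2 q5] := in_Qof_sqrt2_sqrt5.
apply: gen_field_Qof => [z [->|->] //|].
by apply: (subfieldD (@gen_field_subfield _)); apply: gen_field_gen; [left | right].
Qed.

Lemma size_conj_sqrt2_sqrt5 y : in_Qof y sqrt2 -> in_Qof y sqrt5 ->
  size (conj_over sqrt5 y) = (size (conj_over (sqrt2 + sqrt5) y)).*2.
Proof.
move=> y2 y5; have [tau t2 t5] := exists_aut_sqrt2.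
have n2 := gt0_oppr_neq sqrt2_gt0.
apply: (@conj_over_double sqrt5 (sqrt2 + sqrt5) y tau) => //.
- exact: in_QofD.
- by have [] := in_Qof_sqrt2_sqrt5.
- by rewrite rmorphD t2 t5 (inj_eq (addIr _)).
- by rewrite !rmorphD t2 t5 rmorphN t2 opprK t5.
- move=> nu n5; rewrite !rmorphD n5 t2 t5.
  by have [->|->] := aut_sqrt nu sqrt2_sqr; [left | right].
Qed.

Section QuadCase.
Variables (u c : algC) (D : nat) (p0 q : algR) (C0 : algR -> algR) (B mu1 mu2 : rat).
Variable w : forall R : comNzRingType, R -> R -> R.
Hypothesis w_rmorph : forall (R S : comNzRingType) (f : {rmorphism R -> S}) x z,
  f (w x z) = w (f x) (f z).
Hypothesis w_Aint : forall x z, x \in Aint -> z \in Aint -> w x z \in Aint.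
Hypotheses (VA : V_arithmetic (Amat u c (twocos 5))) (u2 : 2 < u) (u14 : u < 14).
Hypothesis c_gt0 : 0 < c.
(** [C0] expresses the conjugate of c^2 through that of the golden ratio: constant for s = 3 and 4,
    and phi^2 for s = 5. *)
Hypothesis Dc : forall (nu : autC) (phi : algR), nu (twocos 5) = algRval phi ->
  nu (c ^+ 2) = algRval (C0 phi).
Hypotheses (Dp : c * twocos 5 = algRval p0) (p0_gt0 : 0 < p0) (p0_le : p0 <= q).
Hypothesis large : forall y phi : algR, 4 <= y <= 196 + 14 * q ->
  phi ^+ 2 = phi + 1 -> 0 < phi -> 0 < w y phi <= ratr B.
Hypothesis small_pos : forall y phi : algR, phi ^+ 2 = phi + 1 -> 0 < phi ->
  - (C0 phi * phi ^+ 2) / 4 <= y -> y <= 4 - C0 phi - phi ^+ 2 -> `|w y phi| <= ratr mu1.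
Hypothesis small_neg : forall y phi : algR, phi ^+ 2 = phi + 1 -> phi < 0 ->
  - (C0 phi * phi ^+ 2) / 4 <= y -> y <= 4 - C0 phi - phi ^+ 2 -> `|w y phi| <= ratr mu2.
Hypotheses (B_gt0 : 0 < B) (mu1_ge0 : 0 <= mu1) (mu2_ge0 : 0 <= mu2).
Hypotheses (mu12 : mu1 * mu2 <= 1) (BD : B * mu1 ^+ D * mu2 ^+ D.+1 < 1).
Let K := ground_field (Amat u c (twocos 5)).
Let y := u ^+ 2 + u * (c * twocos 5).

Let phi_gt0 : 0 < twocos 5.
Proof. by have [] := twocos5. Qed.

Let KE x : K x <-> in_Qof y x.
Proof. exact: ground_field_in_Qof. Qed.

(** The square of [twocos 5] is a cyclic product, and the golden relation recovers [twocos 5] as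
    this square minus 1. *)
Lemma QuadCase_golden : in_Qof y (twocos 5) /\ in_Qof y sqrt5.
Proof.
have [e _ D5] := twocos5.
have y_phi : in_Qof y (twocos 5).
  have -> : twocos 5 = twocos 5 ^+ 2 - 1 by rewrite e addrK.
  have [F1 FB _ _] := in_Qof_subfield y; apply: (FB _ _ _ F1).
  by apply/KE; apply: gen_field_gen; apply: cyc_d2.
split=> // nu nuy; rewrite D5 rmorphB rmorphM rmorph1 rmorph_nat.
by rewrite (y_phi nu nuy).
Qed.

Lemma QuadCase_size : (size (conj_over sqrt5 y) <= D)%N.
Proof.
have [y_phi y5] := QuadCase_golden; have [e _ _] := twocos5.
have phiA : twocos 5 \in Aint.
  have -> : twocos 5 = twocos 5 ^+ 2 - 1 by rewrite e addrK.
  by rewrite rpredB ?rpred1 // (Aint_cyc VA) //; apply: cyc_d2.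
apply: (@degree_bound_quad B mu1 mu2) => //.
have -> : ((size (conj_over sqrt5 y)).*2 - size (conj_over sqrt5 y) =
  size (conj_over (0%R : algC) y) - size (conj_over sqrt5 y))%N by rewrite size_conj_sqrt5.
have range (nu : autC) phi0 : nu (twocos 5) = algRval phi0 -> nu y != y ->
    exists y0, [/\ nu y = algRval y0, - (C0 phi0 * phi0 ^+ 2) / 4 <= y0 &
      y0 <= 4 - C0 phi0 - phi0 ^+ 2].
  move=> Dphi; apply: conj_lift => //; first exact: Dc.
  by rewrite !rmorphXn /= Dphi.
apply: (w_norm_bound w_rmorph w_Aint (phi := twocos 5)) => //; first exact: Aint_y.
- have [y0 [Dy ly]] := identity_lift u2 u14 Dp p0_gt0 p0_le.
  by have [phi0 [Dphi e0 p]] := twocos5_lift; exists y0, phi0; split=> //; apply: large.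
- move=> nu n5 nuy; have [phi0 [Dphi e0 p _]] := twocos5_conj nu.
  have [y0 [Dy l h]] := range nu phi0 Dphi nuy.
  by exists y0, phi0; split=> //; apply: small_pos => //; apply: p.
- move=> nu n5; have [phi0 [Dphi e0 _ p]] := twocos5_conj nu.
  have nuy : nu y != y by apply: contraNneq n5 => nuy; rewrite (y5 nu nuy).
  have [y0 [Dy l h]] := range nu phi0 Dphi nuy.
  by exists y0, phi0; split=> //; apply: small_neg => //; apply: p.
Qed.

Lemma QuadCase_degree :
  [/\ subset_field Qsqrt5 K, degree_le Qsqrt5 K D & degree_le Qfield K D.*2].
Proof.
have [_ y5] := QuadCase_golden; have le_D := QuadCase_size; split.
- by move=> x /Qsqrt5_in_Qof x5; apply/KE; apply: in_Qof_trans y5 x5.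
- exists (size (conj_over sqrt5 y)) => //.
  exact: field_degree_conj Qsqrt5_in_Qof KE y5.
- exists (size (conj_over 0 y)); last by rewrite size_conj_sqrt5 // leq_double.
  by apply: field_degree_conj Qfield_in_Qof KE _ => nu _; rewrite rmorph0.
Qed.

(** Passing from Q(sqrt5) to Q(sqrt2, sqrt5) halves the number of conjugates, so the earlier bound D
    becomes D./2. *)
Lemma QuadCase_degree_sqrt2 : K sqrt2 ->
  subset_field Qsqrt2sqrt5 K /\ degree_le Qsqrt2sqrt5 K D./2.
Proof.
move=> /KE y2; have [_ y5] := QuadCase_golden; have y25 := in_QofD y2 y5; split.
  by move=> x /Qsqrt2sqrt5_in_Qof x25; apply/KE; apply: in_Qof_trans y25 x25.
exists (size (conj_over (sqrt2 + sqrt5) y)).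
  exact: field_degree_conj Qsqrt2sqrt5_in_Qof KE y25.
by rewrite -[X in (X <= _)%N]doubleK half_leq // -size_conj_sqrt2_sqrt5 // QuadCase_size.
Qed.

End QuadCase.

(** * The six cases *)

(** The last product is about 0.85, so 3/40 and 5/4 have little slack. *)
Lemma numerics35 : [/\ 0 < 220 ^+ 3 :> rat, 0 <= 3 / 40 :> rat, 0 <= 5 / 4 :> rat,
  3 / 40 * (5 / 4) <= 1 :> rat & 220 ^+ 3 * (3 / 40) ^+ 7 * (5 / 4) ^+ 8 < 1 :> rat].
Proof. by split; lra. Qed.

Lemma degree_case35 u (K := ground_field (Amat u (twocos 3) (twocos 5))) :
  2 < u -> u < 14 -> V_arithmetic (Amat u (twocos 3) (twocos 5)) ->
  [/\ subset_field Qsqrt5 K, degree_le Qsqrt5 K 7 & degree_le Qfield K 14].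
Proof.
rewrite /K twocos3 => u2 u14 VA; have [B0 mu1 mu2 mu12 BD] := numerics35.
have [phi0 [Dphi e p]] := twocos5_lift; have /andP[_ phi_le] := golden_pos e p.
have Dc (nu : autC) (phi : algR) : nu (twocos 5) = algRval phi -> nu (1 ^+ 2) = algRval 1.
  by rewrite expr1n !rmorph1.
have Dp : 1 * twocos 5 = algRval phi0 by rewrite mul1r.
apply: (QuadCase_degree w35_rmorph w35_Aint VA u2 u14 ltr01 Dc Dp p phi_le _ _ _ B0 mu1 mu2 mu12 BD).
- by move=> y phi ly e1 p1; rewrite rmorphXn rmorph_nat; exact: large35.
- by move=> y phi e1 p1 l h; rewrite fmorph_div !rmorph_nat; exact: bound35_pos.
- by move=> y phi e1 p1 l h; rewrite fmorph_div !rmorph_nat; exact: bound35_neg.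
Qed.

Lemma numerics45 : [/\ 0 < 231 ^+ 3 :> rat, 0 <= 45 / 100 :> rat,
  45 / 100 * (45 / 100) <= 1 :> rat & 231 ^+ 3 * (45 / 100) ^+ 11 * (45 / 100) ^+ 12 < 1 :> rat].
Proof. by split; lra. Qed.

Lemma degree_case45 u (K := ground_field (Amat u (twocos 4) (twocos 5))) :
  2 < u -> u < 14 -> V_arithmetic (Amat u (twocos 4) (twocos 5)) ->
  [/\ subset_field Qsqrt5 K, degree_le Qsqrt5 K 11 & degree_le Qfield K 22] /\
  (K sqrt2 -> subset_field Qsqrt2sqrt5 K /\ degree_le Qsqrt2sqrt5 K 5).
Proof.
rewrite /K twocos4 => u2 u14 VA; have [B0 mu mu12 BD] := numerics45.
have [phi0 [Dphi e p]] := twocos5_lift.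
have [s0 [Ds s2 /andP[s_gt0 _]]] := sqrt2_lift.
have Dc (nu : autC) (phi : algR) : nu (twocos 5) = algRval phi -> nu (sqrt2 ^+ 2) = algRval 2.
  by rewrite sqrt2_sqr !rmorph_nat.
have Dp : sqrt2 * twocos 5 = algRval (s0 * phi0) by rewrite rmorphM Ds Dphi.
have p0_gt0 : 0 < s0 * phi0 by apply: mulr_gt0.
have p0_le := golden_mul_sqrt2_le s2 s_gt0 e p.
have large (y phi : algR) : 4 <= y <= 196 + 14 * (10 / 7 * (89 / 55)) ->
    phi ^+ 2 = phi + 1 -> 0 < phi -> 0 < w45 y phi <= ratr (231 ^+ 3).
  by move=> ly e1 p1; rewrite rmorphXn rmorph_nat; exact: large45.
have pos (y phi : algR) : phi ^+ 2 = phi + 1 -> 0 < phi ->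
    - (2 * phi ^+ 2) / 4 <= y -> y <= 4 - 2 - phi ^+ 2 -> `|w45 y phi| <= ratr (45 / 100).
  by move=> e1 p1 l h; rewrite fmorph_div !rmorph_nat; exact: bound45_pos.
have neg (y phi : algR) : phi ^+ 2 = phi + 1 -> phi < 0 ->
    - (2 * phi ^+ 2) / 4 <= y -> y <= 4 - 2 - phi ^+ 2 -> `|w45 y phi| <= ratr (45 / 100).
  by move=> e1 p1 l h; rewrite fmorph_div !rmorph_nat; exact: bound45_neg.
split.
  exact: (QuadCase_degree w45_rmorph w45_Aint VA u2 u14 sqrt2_gt0 Dc Dp p0_gt0 p0_le
    large pos neg B0 mu mu mu12 BD).
exact: (QuadCase_degree_sqrt2 w45_rmorph w45_Aint VA u2 u14 sqrt2_gt0 Dc Dp p0_gt0 p0_le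
  large pos neg B0 mu mu mu12 BD).
Qed.

Lemma numerics55 : [/\ 0 < 235 ^+ 2 :> rat, 0 <= 5 / 100 :> rat, 0 <= 215 / 100 :> rat,
  5 / 100 * (215 / 100) <= 1 :> rat & 235 ^+ 2 * (5 / 100) ^+ 6 * (215 / 100) ^+ 7 < 1 :> rat].
Proof. by split; lra. Qed.

Lemma degree_case55 u (K := ground_field (Amat u (twocos 5) (twocos 5))) :
  2 < u -> u < 14 -> V_arithmetic (Amat u (twocos 5) (twocos 5)) ->
  [/\ subset_field Qsqrt5 K, degree_le Qsqrt5 K 6 & degree_le Qfield K 12].
Proof.
rewrite /K => u2 u14 VA; have [B0 mu1 mu2 mu12 BD] := numerics55.
have [phi0 [Dphi e p]] := twocos5_lift; have /andP[_ phi_le] := golden_pos e p.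
have c_gt0 : 0 < twocos 5 by have [] := twocos5.
have Dc (nu : autC) (phi : algR) : nu (twocos 5) = algRval phi ->
    nu (twocos 5 ^+ 2) = algRval (phi ^+ 2).
  by move=> Dnu; rewrite !rmorphXn /= Dnu.
have Dp : twocos 5 * twocos 5 = algRval (phi0 + 1).
  by rewrite -e expr2 rmorphM /= Dphi.
have p0_gt0 : 0 < phi0 + 1 := addr_gt0 p ltr01.
have p0_le : phi0 + 1 <= 89 / 55 + 1 := lerD phi_le (lexx 1).
apply: (QuadCase_degree w55_rmorph w55_Aint VA u2 u14 c_gt0 Dc Dp p0_gt0 p0_le
  _ _ _ B0 mu1 mu2 mu12 BD).
- by move=> y phi ly e1 p1; rewrite rmorphXn rmorph_nat; exact: large55.
- by move=> y phi e1 p1 l h; rewrite fmorph_div !rmorph_nat; exact: bound55_pos.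
- by move=> y phi e1 p1 l h; rewrite fmorph_div !rmorph_nat; exact: bound55_neg.
Qed.

Lemma degree_leW (F L : algC -> Prop) m n : (m <= n)%N -> degree_le F L m -> degree_le F L n.
Proof. by move=> mn [k Fk km]; exists k => //; apply: leq_trans mn. Qed.

Unset Implicit Arguments.

Theorem theorem4p7 (s k : nat) (u : algC) :
  (3 <= s)%N -> (s <= k)%N -> (k <= 5)%N ->
  u \in Aint -> totally_real u -> 2 < u -> u < 14 ->
  V_arithmetic (Amat u (twocos s) (twocos k)) ->
  let K := ground_field (Amat u (twocos s) (twocos k)) in
  ((s = 3%N /\ k = 3%N -> degree_le Qfield K 23) /\
   (s = 3%N /\ k = 4%N -> degree_le Qfield K 12) /\
   (s = 4%N /\ k = 4%N -> degree_le Qfield K 8) /\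
   (s = 3%N /\ k = 5%N -> subset_field Qsqrt5 K /\ degree_le Qsqrt5 K 7) /\
   (s = 4%N /\ k = 5%N ->
      (K sqrt2 -> subset_field Qsqrt2sqrt5 K /\ degree_le Qsqrt2sqrt5 K 5) /\
      (~ K sqrt2 -> subset_field Qsqrt5 K /\ degree_le Qsqrt5 K 11)) /\
   (s = 5%N /\ k = 5%N -> subset_field Qsqrt5 K /\ degree_le Qsqrt5 K 6)) /\
  degree_le Qfield K 23.
Proof.
move=> s3 sk k5 _ _ u2 u14 VA K; case: (ltngtP s 3) s3 => // [s4|Ds] _; last subst s.
  have [Ds|Ds] : s = 4%N \/ s = 5%N.
  - by move: (leq_trans sk k5) s4; clear; case: s => [|[|[|[|[|[|?]]]]]]; auto.
  - subst s; have [Dk|Dk] : k = 4%N \/ k = 5%N.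
    + by move: sk k5; clear; case: k => [|[|[|[|[|[|?]]]]]]; auto.
    + subst k; have d := degree_case44 u2 u14 VA.
      by split; [repeat match goal with |- _ /\ _ => split end; case | apply: degree_leW d].
    + subst k; have [[sub5 d5 d] d25] := degree_case45 u2 u14 VA.
      by split; [repeat match goal with |- _ /\ _ => split end; case | apply: degree_leW d].
  - subst s; have Dk : k = 5%N by apply/eqP; rewrite eqn_leq sk k5.
    subst k; have [sub5 d5 d] := degree_case55 u2 u14 VA.
    by split; [repeat match goal with |- _ /\ _ => split end; case | apply: degree_leW d].
have [Dk|[Dk|Dk]] : k = 3%N \/ k = 4%N \/ k = 5%N.
- by move: sk k5; clear; case: k => [|[|[|[|[|[|?]]]]]]; auto.
- subst k; have d := degree_case33 u2 u14 VA.
  by split; [repeat match goal with |- _ /\ _ => split end; case | apply: degree_leW d].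
- subst k; have d := degree_case34 u2 u14 VA.
  by split; [repeat match goal with |- _ /\ _ => split end; case | apply: degree_leW d].
- subst k; have [sub5 d5 d] := degree_case35 u2 u14 VA.
  by split; [repeat match goal with |- _ /\ _ => split end; case | apply: degree_leW d].
Qed.
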